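(* Let $(X,\Sigma,\mu)$ be a complete $\sigma$-finite measure space, let $\mathcal{A}\subseteq\Sigma$ be a complete $\sigma$-finite sub-$\sigma$-algebra with conditional expectation operator $E$, and let $\Phi$ be a Young function satisfying the $\Delta_2$-condition. Suppose that $(X,\mathcal{A},\mu|_{\mathcal{A}})$ is non-atomic, and let $u\in K^{*}_{\Phi}$. If the $*$-multiplication operator $T_u:L^{\Phi}(\Sigma)\to L^{\Phi}(\Sigma)$, $T_uf=u*f$, is a Fredholm operator, then there exists $\delta>0$ such that $|E(u)|\ge\delta$ almost everywhere on $X$.
   Context: A Young function is a continuous convex function $\Phi:\mathbb{R}\to\mathbb{R}^+=[0,\infty)$ with $\Phi(x)=\Phi(-x)$, $\Phi(0)=0$ and $\lim_{x\to\infty}\Phi(x)=+\infty$. It satisfies the $\Delta_2$-condition if there are $k>0$ and $x_0\ge 0$ with $\Phi(2x)\le k\Phi(x)$ for all $x\ge x_0$ (globally, if $x_0=0$). The Orlicz space $L^{\Phi}(\Sigma)$ is the set of $\Sigma$-measurable $f:X\to\mathbb{C}$ (modulo a.e. equality) with $\int_X\Phi(\varepsilon|f|)\,d\mu<\infty$ for some $\varepsilon>0$, a Banach space under the norm $\|f\|_{\Phi}=\inf\{\varepsilon>0:\int_X\Phi(|f|/\varepsilon)\,d\mu\le 1\}$. $L^0(\Sigma)$ denotes the space of (classes of) a.e. finite-valued $\Sigma$-measurable functions, and similarly $L^0(\mathcal{A})$. For nonnegative $f\in L^0(\Sigma)$ (or $f\in L^p(\Sigma)$), $E(f)$ denotes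 the conditional expectation of $f$ with respect to $\mathcal{A}$: the unique $\mathcal{A}$-measurable function with $\int_A f\,d\mu=\int_A E(f)\,d\mu$ for every $A\in\mathcal{A}$ for which $\int_A f\,d\mu$ converges. $D(E)=\{f\in L^0(\Sigma):E(|f|)\in L^0(\mathcal{A})\}$ is the set of conditionable functions, on which $E$ is defined by linearity. For $f,g\in D(E)$ put $f*g=fE(g)+gE(f)-E(f)E(g)$. The set of Lambert multipliers on $L^\Phi(\Sigma)$ is $K^{*}_{\Phi}=\{u\in D(E):u*f\in L^{\Phi}(\Sigma)\text{ for all }f\in L^{\Phi}(\Sigma)\}$. For $u\in K^{*}_{\Phi}$ the operator $T_u$ is bounded. $T_u$ is Fredholm if its range is closed, its kernel is finite-dimensional, and its range has finite codimension. An $\mathcal{A}$-atom is a set $A\in\mathcal{A}$ with $\mu(A)>0$ such that every $F\in\mathcal{A}$ with $F\subseteq A$ satisfies $\mu(F)=0$ or $\mu(F)=\mu(A)$; $(X,\mathcal{A},\mu|_{\mathcal{A}})$ is non-atomic if it has no $\mathcal{A}$-atoms. *)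

(* Defs.v *)
From HB Require Import structures.
From mathcomp Require Import all_boot all_order all_algebra.
From mathcomp Require Import complex.
From mathcomp Require Import all_classical all_reals all_analysis.
From mathcomp Require Import measurable_realfun.
From mathcomp Require Import ring lra.

Set Implicit Arguments.
Unset Strict Implicit.
Unset Printing Implicit Defensive.

Import Order.TTheory GRing.Theory Num.Theory.
Import numFieldNormedType.Exports.

Local Open Scope classical_set_scope.
Local Open Scope ring_scope.
Local Open Scope complex_scope.

Notation normc := ComplexField.Normc.normc.

Record youngFun (R : realType) := YoungFun {
  young_fun :> R -> R;
  young_continuous : continuous young_fun;
  young_convex : @convex_function R R^o setT young_fun;
  young_ge0 : forall x, 0 <= young_fun x;
  young_even : forall x, young_fun x = young_fun (- x);
  young0 : young_fun 0 = 0;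
  young_cvgy : young_fun x @[x --> +oo] --> +oo }.

Definition Delta2 (R : realType) (Phi : R -> R) :=
  exists k x0 : R, [/\ 0 < k, 0 <= x0 &
    forall x, x0 <= x -> Phi (2 * x) <= k * Phi x].

(* Borel measurability into R[i], identified with R * R *)
Definition cmeasurable d (X : measurableType d) (R : realType)
    (f : X -> R[i]) :=
  measurable_fun setT (fun x => complex.Re (f x)) /\
  measurable_fun setT (fun x => complex.Im (f x)).

Section orlicz_functions.
Context d (X : measurableType d) (R : realType).
Variables (mu : {measure set X -> \bar R}) (Phi : youngFun R).
Implicit Types (f g : X -> R[i]).

Definition Phi_integral (c : R) f : \bar R :=
  (\int[mu]_x (Phi (c * normc (f x)))%:E)%E.

Definition is_orlicz f :=
  cmeasurable f /\ exists2 c : R, 0 < c & (Phi_integral c f < +oo)%E.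

Definition luxemburg f : R :=
  inf [set c : R | 0 < c /\ (Phi_integral c^-1 f <= 1)%E].

End orlicz_functions.

Section young_theory.
Context (R : realType) (Phi : youngFun R).

Lemma young_convexE (t x y : R) : 0 <= t <= 1 ->
  Phi (t * x + (1 - t) * y) <= t * Phi x + (1 - t) * Phi y.
Proof.
move=> /andP[t0 t1].
by have := @young_convex _ Phi (Itv01 t0 t1) x y (mem_set I) (mem_set I).
Qed.

Lemma young_scale (t x : R) : 0 <= t <= 1 -> Phi (t * x) <= t * Phi x.
Proof.
by move=> /(young_convexE x 0); rewrite young0 !mulr0 !addr0.
Qed.

Lemma young_le (x y : R) : 0 <= x -> x <= y -> Phi x <= Phi y.
Proof.
move=> x0 xy; have [y0|y0] := eqVneq y 0.
  by have -> : x = y by apply/eqP; rewrite eq_le xy y0 x0.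
have yp : 0 < y by rewrite lt_neqAle eq_sym y0 (le_trans x0).
have t01 : 0 <= x / y <= 1.
  by rewrite divr_ge0 ?(ltW yp)//= ler_pdivrMr// mul1r.
rewrite -{1}[x](divfK y0); apply: (le_trans (young_scale y t01)).
by rewrite ler_piMl ?young_ge0//; case/andP: t01.
Qed.

Lemma young_measurable : measurable_fun setT Phi.
Proof. by apply: continuous_measurable_fun; exact: young_continuous. Qed.

End young_theory.

Section orlicz_theory.
Context d (X : measurableType d) (R : realType).
Variables (mu : {measure set X -> \bar R}) (Phi : youngFun R).
Implicit Types (f g : X -> R[i]) (a b c : R).

Let normc_ge0 (z : R[i]) : 0 <= normc z.
Proof. by case: z => x y; exact: sqrtr_ge0. Qed.

Let normcZ (z w : R[i]) : normc (z *: w) = normc z * normc w.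
Proof. exact: ComplexField.Normc.normcM. Qed.

Lemma measurable_normc f : cmeasurable f ->
  measurable_fun setT (fun x => normc (f x)).
Proof.
move=> [mR mI].
have -> : (fun x => normc (f x)) =
    Num.sqrt \o (fun x => complex.Re (f x) ^+ 2 + complex.Im (f x) ^+ 2).
  by apply/funext => x /=; case: (f x).
apply: measurableT_comp; first by apply: continuous_measurable_fun; exact: sqrt_continuous.
by apply: measurable_funD; exact: measurable_funX.
Qed.

Lemma measurable_Phi c f : cmeasurable f ->
  measurable_fun setT (fun x => (Phi (c * normc (f x)))%:E).
Proof.
move=> mf; apply/measurable_EFinP/measurableT_comp; first exact: young_measurable.
by apply: measurable_funM => //; exact: measurable_normc.
Qed.

Lemma cmeasurableD f g : cmeasurable f -> cmeasurable g -> cmeasurable (f + g).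
Proof.
move=> [fR fI] [gR gI]; split.
- rewrite [X in measurable_fun _ X](_ : _ =
    (fun x => complex.Re (f x)) \+ (fun x => complex.Re (g x))).
    exact: measurable_funD.
  by apply/funext => x /=; rewrite /GRing.add/=; case: (f x); case: (g x).
- rewrite [X in measurable_fun _ X](_ : _ =
    (fun x => complex.Im (f x)) \+ (fun x => complex.Im (g x))).
    exact: measurable_funD.
  by apply/funext => x /=; rewrite /GRing.add/=; case: (f x); case: (g x).
Qed.

Lemma cmeasurableZ (k : R[i]) f : cmeasurable f -> cmeasurable (k *: f).
Proof.
case: k => a b [fR fI]; split.
- rewrite [X in measurable_fun _ X](_ : _ =
    (fun x => a * complex.Re (f x) - b * complex.Im (f x))).
    by apply: measurable_funB; apply: measurable_funM.
  by apply/funext => x /=; rewrite fctE /GRing.scale/=; case: (f x).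
- rewrite [X in measurable_fun _ X](_ : _ =
    (fun x => a * complex.Im (f x) + b * complex.Re (f x))).
    by apply: measurable_funD; apply: measurable_funM.
  by apply/funext => x /=; rewrite fctE /GRing.scale/=; case: (f x).
Qed.

Lemma is_orlicz0 : is_orlicz mu Phi 0.
Proof.
split; first by split; exact: measurable_cst.
exists 1 => //; rewrite /Phi_integral (eq_integral (cst 0%E)) ?integral0//.
by move=> x _; rewrite ComplexField.Normc.normc0 mulr0 young0.
Qed.

Lemma Phi_integralD (t : R) a b f g : 0 <= t <= 1 -> 0 <= a -> 0 <= b ->
  cmeasurable f -> cmeasurable g ->
  forall c, 0 <= c -> c <= t * a -> c <= (1 - t) * b ->
  (Phi_integral mu Phi c (f + g)%R <=
   t%:E * Phi_integral mu Phi a f + (1 - t)%R%:E * Phi_integral mu Phi b g)%E.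
Proof.
move=> t01 a0 b0 mf mg c c0 ca cb.
have [t0 t1] : 0 <= t /\ 0 <= 1 - t by move/andP: t01 => [*]; split; lra.
rewrite /Phi_integral -!ge0_integralZl//; last 4 first.
  exact: measurable_Phi. by move=> x _; rewrite lee_fin young_ge0.
  exact: measurable_Phi. by move=> x _; rewrite lee_fin young_ge0.
rewrite -ge0_integralD//; last 4 first.
  by move=> x _; rewrite -EFinM lee_fin mulr_ge0// young_ge0.
  by apply: measurable_funeM; exact: measurable_Phi.
  by move=> x _; rewrite -EFinM lee_fin mulr_ge0// young_ge0.
  by apply: measurable_funeM; exact: measurable_Phi.
apply: ge0_le_integral => //.
- by move=> x _; rewrite lee_fin young_ge0.
- exact/measurable_Phi/cmeasurableD.
- by apply: emeasurable_funD; apply: measurable_funeM; exact: measurable_Phi.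
move=> x _; rewrite -!EFinM -EFinD lee_fin.
apply: le_trans (young_convexE Phi _ _ t01).
apply: young_le; first by rewrite mulr_ge0.
apply: (@le_trans _ _ (c * (normc (f x) + normc (g x)))).
  by rewrite ler_wpM2l//; exact: le_normcD.
by rewrite mulrDr !mulrA lerD// ler_wpM2r.
Qed.

Lemma Phi_integral_le a b f : 0 <= a -> a <= b -> cmeasurable f ->
  (Phi_integral mu Phi a f <= Phi_integral mu Phi b f)%E.
Proof.
move=> a0 ab mf; apply: ge0_le_integral => //.
- by move=> x _; rewrite lee_fin young_ge0.
- exact: measurable_Phi.
- exact: measurable_Phi.
- by move=> x _; rewrite lee_fin young_le ?mulr_ge0// ler_wpM2r.
Qed.

Lemma Phi_integral_ge0 c f : (0 <= Phi_integral mu Phi c f)%E.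
Proof. by apply: integral_ge0 => x _; rewrite lee_fin young_ge0. Qed.

Lemma Phi_integralZ (k : R[i]) c f :
  Phi_integral mu Phi c (k *: f) = Phi_integral mu Phi (c * normc k) f.
Proof. by apply: eq_integral => x _; rewrite fctE normcZ mulrA. Qed.

Lemma is_orliczD f g : is_orlicz mu Phi f -> is_orlicz mu Phi g ->
  is_orlicz mu Phi (f + g).
Proof.
move=> [mf [a a0 fa]] [mg [b b0 gb]]; split; first exact: cmeasurableD.
have h0 : 0 < Num.min a b / 2 by rewrite divr_gt0// lt_min a0.
exists (Num.min a b / 2) => //.
have t01 : 0 <= (2^-1 : R) <= 1 by apply/andP; split; lra.
have am : Num.min a b <= a by rewrite ge_min lexx.
have bm : Num.min a b <= b by rewrite ge_min lexx orbT.
have h1 : Num.min a b / 2 <= 2^-1 * a by lra.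
have h2 : Num.min a b / 2 <= (1 - 2^-1) * b by lra.
apply: (le_lt_trans
  (Phi_integralD t01 (ltW a0) (ltW b0) mf mg (ltW h0) h1 h2)).
by rewrite lte_add_pinfty// lte_mul_pinfty// lee_fin; lra.
Qed.

Lemma is_orliczZ (k : R[i]) f : is_orlicz mu Phi f -> is_orlicz mu Phi (k *: f).
Proof.
move=> [mf [a a0 fa]]; split; first exact: cmeasurableZ.
have k0 : 0 < normc k + 1 by rewrite ltr_wpDl.
exists (a / (normc k + 1)); first by rewrite divr_gt0.
rewrite Phi_integralZ; apply: le_lt_trans fa.
apply: Phi_integral_le => //; first by rewrite mulr_ge0// divr_ge0// ltW.
by rewrite mulrAC ler_pdivrMr// ler_wpM2l ?(ltW a0)// lerDl.
Qed.

Let lset f := [set c : R | 0 < c /\ (Phi_integral mu Phi c^-1 f <= 1)%E].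

Lemma luxemburg_has_inf f : is_orlicz mu Phi f -> has_inf (lset f).
Proof.
move=> [mf [a a0 fa]]; split; last by exists 0 => c [/ltW].
have I0 := Phi_integral_ge0 a f.
set I := fine (Phi_integral mu Phi a f).
have IE : (Phi_integral mu Phi a f = I%:E)%E by rewrite fineK// ge0_fin_numE.
have Ip : 0 <= I by rewrite fine_ge0.
have I1 : 0 < I + 1 by rewrite ltr_wpDl.
have iI1 : 0 < (I + 1)^-1 by rewrite invr_gt0.
have tt : (I + 1)^-1 * (I + 1) = 1 by rewrite mulVf// gt_eqF.
have t01 : 0 <= (I + 1)^-1 <= 1 by apply/andP; split; nra.
exists ((I + 1) / a); split; first by rewrite divr_gt0.
apply: (@le_trans _ _ ((I + 1)^-1%:E * Phi_integral mu Phi a f)%E); last first.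
  by rewrite IE -EFinM lee_fin; nra.
rewrite /Phi_integral -ge0_integralZl//; last 3 first.
- exact: measurable_Phi.
- by move=> x _; rewrite lee_fin young_ge0.
- by rewrite lee_fin ltW.
apply: ge0_le_integral => //.
- by move=> x _; rewrite lee_fin young_ge0.
- exact: measurable_Phi.
- by apply: measurable_funeM; exact: measurable_Phi.
move=> x _; rewrite -EFinM lee_fin invf_div mulrAC mulrC -[X in Phi X]/(_ * _).
exact: young_scale.
Qed.

Lemma luxemburg_ge0 f : is_orlicz mu Phi f -> 0 <= luxemburg mu Phi f.
Proof.
by move=> /luxemburg_has_inf[n0 _]; apply: lb_le_inf => // c [/ltW].
Qed.

Lemma luxemburg_le c f : is_orlicz mu Phi f -> 0 < c ->
  (Phi_integral mu Phi c^-1 f <= 1)%E -> luxemburg mu Phi f <= c.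
Proof.
by move=> /luxemburg_has_inf[_ lb] c0 c1; apply: ge_inf.
Qed.

Lemma Phi_integral_luxemburg c f : is_orlicz mu Phi f ->
  luxemburg mu Phi f < c -> (Phi_integral mu Phi c^-1 f <= 1)%E.
Proof.
move=> of_ fc; have hi := luxemburg_has_inf of_.
have [e [e0 e1] ec] := inf_adherent (etrans (subr_gt0 _ _) fc) hi.
have {}ec : e < c by move: ec; rewrite addrC subrK.
apply: le_trans e1; apply: Phi_integral_le; last by case: of_.
  by rewrite invr_ge0; exact: ltW (lt_trans e0 ec).
by rewrite lef_pV2 ?posrE//; [exact: ltW|exact: lt_trans ec].
Qed.

Lemma luxemburgD f g : is_orlicz mu Phi f -> is_orlicz mu Phi g ->
  luxemburg mu Phi (f + g) <= luxemburg mu Phi f + luxemburg mu Phi g.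
Proof.
move=> of_ og; apply/ler_addgt0Pr => e e0.
pose a := luxemburg mu Phi f + e / 2; pose b := luxemburg mu Phi g + e / 2.
have e20 : 0 < e / 2 by rewrite divr_gt0.
have a0 : 0 < a by rewrite ltr_wpDl// luxemburg_ge0.
have b0 : 0 < b by rewrite ltr_wpDl// luxemburg_ge0.
have -> : luxemburg mu Phi f + luxemburg mu Phi g + e = a + b.
  by rewrite /a /b; lra.
have ab0 : 0 < a + b by rewrite addr_gt0.
have fa : (Phi_integral mu Phi a^-1 f <= 1)%E.
  by apply: Phi_integral_luxemburg => //; rewrite ltrDl.
have gb : (Phi_integral mu Phi b^-1 g <= 1)%E.
  by apply: Phi_integral_luxemburg => //; rewrite ltrDl.
apply: luxemburg_le => //; first exact: is_orliczD.
have t01 : 0 <= a / (a + b) <= 1.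
  apply/andP; split; first exact: divr_ge0 (ltW a0) (ltW ab0).
  by rewrite ler_pdivrMr// mul1r lerDl ltW.
have h0 : 0 <= (a + b)^-1 by rewrite invr_ge0 ltW.
have h1 : (a + b)^-1 <= a / (a + b) * a^-1.
  by rewrite mulrAC divff ?gt_eqF// mul1r.
have h2 : (a + b)^-1 <= (1 - a / (a + b)) * b^-1.
  have -> : 1 - a / (a + b) = b / (a + b) by field; rewrite gt_eqF.
  by rewrite mulrAC divff ?gt_eqF// mul1r.
have ia0 : 0 <= a^-1 by rewrite invr_ge0 ltW.
have ib0 : 0 <= b^-1 by rewrite invr_ge0 ltW.
have [mf _] := of_; have [mg _] := og.
apply: (le_trans (Phi_integralD t01 ia0 ib0 mf mg h0 h1 h2)).
have -> : (1 = (a / (a + b))%:E * 1 + (1 - a / (a + b))%R%:E * 1 :> \bar R)%E.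
  by rewrite !mule1 -EFinD addrC subrK.
move: t01 => /andP[t0 t1].
by apply: leeD; apply: lee_wpmul2l => //; rewrite lee_fin// subr_ge0.
Qed.

Lemma luxemburg0 : luxemburg mu Phi 0 = 0.
Proof.
apply/eqP; rewrite eq_le luxemburg_ge0 ?andbT; last exact: is_orlicz0.
apply/ler_addgt0Pr => e e0; rewrite add0r.
apply: luxemburg_le => //; first exact: is_orlicz0.
rewrite /Phi_integral (eq_integral (cst 0%E)) ?integral0//.
by move=> x _; rewrite ComplexField.Normc.normc0 mulr0 young0.
Qed.

Let luxemburgZ_le (k : R[i]) f : k != 0 -> is_orlicz mu Phi f ->
  luxemburg mu Phi (k *: f) <= normc k * luxemburg mu Phi f.
Proof.
move=> k0 of_.
have nk0 : 0 < normc k.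
  rewrite lt_neqAle normc_ge0 andbT eq_sym.
  by apply: contra_neq k0; exact: ComplexField.Normc.eq0_normc.
rewrite -ler_pdivrMl//; apply/ler_addgt0Pr => e e0.
rewrite ler_pdivrMl//.
have c0 : 0 < luxemburg mu Phi f + e by rewrite ltr_wpDl// luxemburg_ge0.
apply: luxemburg_le; [exact: is_orliczZ|exact: mulr_gt0|].
rewrite Phi_integralZ invfM mulrAC mulVf ?gt_eqF// mul1r.
by apply: Phi_integral_luxemburg => //; rewrite ltrDl.
Qed.

Lemma luxemburgZ (k : R[i]) f : is_orlicz mu Phi f ->
  luxemburg mu Phi (k *: f) = normc k * luxemburg mu Phi f.
Proof.
move=> of_; have [->|k0] := eqVneq k 0.
  by rewrite scale0r luxemburg0 ComplexField.Normc.normc0 mul0r.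
have nk0 : 0 < normc k.
  rewrite lt_neqAle normc_ge0 andbT eq_sym.
  by apply: contra_neq k0; exact: ComplexField.Normc.eq0_normc.
apply/eqP; rewrite eq_le luxemburgZ_le//=.
have ki0 : k^-1 != 0 by rewrite invr_eq0.
have := luxemburgZ_le ki0 (is_orliczZ k of_).
by rewrite scalerA mulVf// scale1r ComplexField.Normc.normcV ler_pdivlMl.
Qed.

Lemma Phi_integral_ae c f g : cmeasurable f -> cmeasurable g ->
  {ae mu, forall x, f x = g x} ->
  Phi_integral mu Phi c f = Phi_integral mu Phi c g.
Proof.
move=> mf mg fg; apply: ae_eq_integral => //; try exact: measurable_Phi.
by apply: filterS fg => x /= fg _; rewrite fg.
Qed.

Lemma luxemburg_ae f g : cmeasurable f -> cmeasurable g ->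
  {ae mu, forall x, f x = g x} -> luxemburg mu Phi f = luxemburg mu Phi g.
Proof.
move=> mf mg fg; rewrite /luxemburg; congr inf.
by apply/seteqP; split=> c /=; rewrite (Phi_integral_ae _ mf mg fg).
Qed.

Lemma luxemburg_eq0 f : is_orlicz mu Phi f -> luxemburg mu Phi f = 0 ->
  {ae mu, forall x, f x = 0}.
Proof.
move=> of_ f0; have [mf _] := of_.
have I1 c : 0 < c -> (Phi_integral mu Phi c f <= 1)%E.
  move=> c0; rewrite -[c]invrK; apply: Phi_integral_luxemburg => //.
  by rewrite f0 invr_gt0.
pose A n := [set x | n.+1%:R^-1 <= normc (f x)].
have mA n : measurable (A n).
  rewrite -[A n]setTI; apply: measurable_fun_le => //.
  exact: measurable_normc.
have A0 n : mu (A n) = 0%E.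
  apply/eqP; rewrite -measure_le0; apply/lee_addgt0Pr => e e0; rewrite add0e.
  have /cvgryPge /(_ e^-1) [M [_ MP]] := @young_cvgy _ Phi.
  pose y := Num.max M 0 + 1.
  have y0 : 0 < y by rewrite ltr_wpDl// le_max lexx orbT.
  have Py : e^-1 <= Phi y.
    by apply: MP; rewrite /y (@le_lt_trans _ _ (Num.max M 0)) ?ltrDl// le_max lexx.
  have c0 : 0 < y * n.+1%:R by rewrite mulr_gt0.
  rewrite -[leLHS]mul1e -[leRHS]mule1.
  rewrite -{1}(@mulfV _ e) ?gt_eqF// EFinM -muleA lee_pmul2l//.
  apply: le_trans (I1 _ c0).
  rewrite -integral_cst//.
  apply: (@le_trans _ _ (\int[mu]_(x in A n) (Phi (y * n.+1%:R * normc (f x)))%:E)%E).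
    apply: ge0_le_integral => //.
    - by move=> x _; rewrite lee_fin invr_ge0 ltW.
    - by apply: measurable_funTS; exact: measurable_Phi.
    - move=> x Ax; rewrite lee_fin (le_trans Py)// young_le ?(ltW y0)//.
      by rewrite -mulrA ler_peMr ?(ltW y0)// -ler_pdivrMl// mulr1.
  apply: ge0_subset_integral => //; first exact: measurable_Phi.
  by move=> x _; rewrite lee_fin young_ge0.
have : mu.-negligible (\bigcup_n A n).
  by apply: negligible_bigcup => n; exists (A n); split.
apply: negligibleS => x /= fx0; have {}fx0 : 0 < normc (f x).
  rewrite lt_neqAle normc_ge0 andbT eq_sym; apply/eqP => nfx.
  exact/fx0/ComplexField.Normc.eq0_normc.
exists (Num.bound (normc (f x))^-1) => //=; rewrite /A/= invf_ple ?posrE//.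
have := archi_boundP (ltW (etrans (invr_gt0 _) fx0)).
by move=> /ltW /le_trans; apply; rewrite ler_nat.
Qed.

End orlicz_theory.

Section orlicz_space.
Context d (X : measurableType d) (R : realType).
Variables (mu : {measure set X -> \bar R}) (Phi : youngFun R).

Definition orlicz_pred : {pred X -> R[i]} := mem [set f | is_orlicz mu Phi f].

Lemma orlicz_predP (f : X -> R[i]) :
  reflect (is_orlicz mu Phi f) (f \in orlicz_pred).
Proof. by rewrite /orlicz_pred; apply: (iffP idP) => [/set_mem|/mem_set]. Qed.

Lemma orlicz_submod_closed : submod_closed orlicz_pred.
Proof.
split; first exact/orlicz_predP/is_orlicz0.
move=> k f g /orlicz_predP f_ /orlicz_predP g_.
exact/orlicz_predP/is_orliczD/g_/is_orliczZ.
Qed.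

HB.instance Definition _ :=
  GRing.isSubmodClosed.Build R[i] (X -> R[i]) orlicz_pred orlicz_submod_closed.

Record orliczFun := OrliczFun {
  orlicz_fun :> X -> R[i];
  orlicz_funP : orlicz_fun \in orlicz_pred }.

HB.instance Definition _ := [isSub for orlicz_fun].
HB.instance Definition _ := [Choice of orliczFun by <:].
HB.instance Definition _ := [SubChoice_isSubLmodule of orliczFun by <:].

Lemma is_orlicz_fun (f : orliczFun) : is_orlicz mu Phi f.
Proof. exact/orlicz_predP/orlicz_funP. Qed.

Definition ae0 : {pred orliczFun} :=
  [pred f : orliczFun | `[< {ae mu, forall x, f x = 0} >]].

Lemma ae0P (f : orliczFun) :
  reflect {ae mu, forall x, f x = 0} (f \in ae0).
Proof. by apply: (iffP idP) => [/asboolP|/asboolP]. Qed.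

Lemma ae0_zmod_closed : zmod_closed ae0.
Proof.
split; first by apply/ae0P; exact: aeW.
move=> f g /ae0P f0 /ae0P g0; apply/ae0P.
by apply: filterS2 f0 g0 => x /= + +; rewrite !fctE => -> ->; rewrite subr0.
Qed.

HB.instance Definition _ := GRing.isZmodClosed.Build orliczFun ae0 ae0_zmod_closed.

Definition orlicz : Type := Quotient.quot ae0.
HB.instance Definition _ := GRing.Zmodule.on orlicz.
HB.instance Definition _ := EqQuotient.on orlicz.

Definition orlicz_class : orliczFun -> orlicz := \pi_orlicz%qT.

Lemma orlicz_classP (f g : orliczFun) :
  orlicz_class f = orlicz_class g <-> {ae mu, forall x, f x = g x}.
Proof.
split=> [/eqP|fg].
  rewrite -Quotient.idealrBE => /ae0P; apply: filterS => x /= /eqP.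
  by rewrite subr_eq0 => /eqP.
apply/eqP; rewrite -Quotient.idealrBE; apply/ae0P.
by apply: filterS fg => x /= fg; rewrite !fctE fg subrr.
Qed.

Definition orlicz_repr : orlicz -> orliczFun := @repr _ orlicz.

Lemma orlicz_reprK : cancel orlicz_repr orlicz_class.
Proof. exact: reprK. Qed.

Lemma orlicz_repr_class (f : orliczFun) :
  {ae mu, forall x, orlicz_repr (orlicz_class f) x = f x}.
Proof. by apply/orlicz_classP; rewrite orlicz_reprK. Qed.

Lemma orlicz_classD (f g : orliczFun) :
  orlicz_class (f + g) = orlicz_class f + orlicz_class g.
Proof. exact: pi_addr. Qed.

Definition orlicz_scale (k : R[i]) (F : orlicz) : orlicz :=
  orlicz_class (k *: orlicz_repr F).

Let orlicz_scaleE k f : orlicz_scale k (orlicz_class f) = orlicz_class (k *: f).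
Proof.
apply/orlicz_classP; apply: filterS (orlicz_repr_class f) => x /= fx.
by rewrite !fctE fx.
Qed.

Let orlicz_scaleA a b F :
  orlicz_scale a (orlicz_scale b F) = orlicz_scale (a * b) F.
Proof. by rewrite -[F]orlicz_reprK !orlicz_scaleE scalerA. Qed.

Let orlicz_scale1 : left_id 1 orlicz_scale.
Proof. by move=> F; rewrite -[F]orlicz_reprK orlicz_scaleE scale1r. Qed.

Let orlicz_scaleDr : right_distributive orlicz_scale +%R.
Proof.
move=> a F G; rewrite -[F]orlicz_reprK -[G]orlicz_reprK !orlicz_scaleE.
by rewrite -!orlicz_classD orlicz_scaleE scalerDr.
Qed.

Let orlicz_scaleDl F : {morph orlicz_scale^~ F : a b / a + b}.
Proof.
move=> a b; rewrite -[F]orlicz_reprK !orlicz_scaleE -orlicz_classD.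
by rewrite scalerDl.
Qed.

HB.instance Definition _ := GRing.Zmodule_isLmodule.Build R[i] orlicz
  orlicz_scaleA orlicz_scale1 orlicz_scaleDr orlicz_scaleDl.

Lemma orlicz_classZ (k : R[i]) (f : orliczFun) :
  orlicz_class (k *: f) = k *: orlicz_class f.
Proof. by rewrite -orlicz_scaleE. Qed.

(* normedModType R[i] takes its norms in R[i] *)
Definition orlicz_norm (F : orlicz) : R[i] :=
  (luxemburg mu Phi (orlicz_repr F))%:C.

Lemma orlicz_normE (f : orliczFun) :
  orlicz_norm (orlicz_class f) = (luxemburg mu Phi f)%:C.
Proof.
congr _%:C; apply: luxemburg_ae; last exact: orlicz_repr_class.
  by case: (is_orlicz_fun (orlicz_repr (orlicz_class f))).
by case: (is_orlicz_fun f).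
Qed.

Let orlicz_normD F G : orlicz_norm (F + G) <= orlicz_norm F + orlicz_norm G.
Proof.
rewrite -[F]orlicz_reprK -[G]orlicz_reprK -orlicz_classD !orlicz_normE.
by rewrite -rmorphD lecR luxemburgD//; exact: is_orlicz_fun.
Qed.

Let orlicz_normZ k F : orlicz_norm (k *: F) = `|k| * orlicz_norm F.
Proof.
rewrite -[F]orlicz_reprK -orlicz_classZ !orlicz_normE luxemburgZ.
  by rewrite rmorphM.
exact: is_orlicz_fun.
Qed.

Let orlicz_norm_eq0 F : orlicz_norm F = 0 -> F = 0.
Proof.
rewrite -[F]orlicz_reprK orlicz_normE => /complexI F0.
have <- : orlicz_class 0 = 0 by exact: pi_zeror.
by apply/orlicz_classP/(luxemburg_eq0 (is_orlicz_fun _)).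
Qed.

HB.instance Definition _ := @Lmodule_isNormed.Build R[i] orlicz
  orlicz_norm orlicz_normD orlicz_normZ orlicz_norm_eq0.

Lemma orlicz_normrE (f : orliczFun) :
  `|orlicz_class f| = (luxemburg mu Phi f)%:C.
Proof. exact: orlicz_normE. Qed.

End orlicz_space.

Section conditional_expectation.
Context d (X : measurableType d) (R : realType).
Variables (mu : {measure set X -> \bar R}) (A : set (set X)).

(* The sub-sigma-algebra is the set of sets A; A-measurability is
   measurability from g_sigma_algebraType A, whose measurable sets are exactly
   the elements of A when A is a sigma-algebra.
   The integrals of nonnegative functions are taken in [0, +oo], so that the
   identity is required for every B in A: this is what makes g a.e. unique even
   where it is infinite. *)
Definition is_condexp (f g : X -> \bar R) :=
  [/\ measurable_fun [set: g_sigma_algebraType A]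
        (g : g_sigma_algebraType A -> \bar R),
      forall x, (0 <= g x)%E &
      forall B, A B -> (\int[mu]_(x in B) f x = \int[mu]_(x in B) g x)%E].

(* A version of E(f), for f nonnegative measurable. Such a g exists by
   Radon-Nikodym when mu is sigma-finite on A. *)
Definition condexp_ge0 (f : X -> \bar R) : X -> \bar R :=
  get [set g | is_condexp f g].

Definition conditionable (f : X -> R[i]) :=
  cmeasurable f /\
  {ae mu, forall x, (condexp_ge0 (fun y => (normc (f y))%:E) x < +oo)%E}.

Definition condexp_real (f : X -> R) (x : X) : R :=
  fine (condexp_ge0 (fun y => (Num.max (f y) 0)%:E) x) -
  fine (condexp_ge0 (fun y => (Num.max (- f y) 0)%:E) x).

Definition condexp (f : X -> R[i]) (x : X) : R[i] :=
  condexp_real (fun y => complex.Re (f y)) x +i*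
  condexp_real (fun y => complex.Im (f y)) x.

Definition lambert_mul (f g : X -> R[i]) (x : X) : R[i] :=
  f x * condexp g x + g x * condexp f x - condexp f x * condexp g x.

Definition is_atom (B : set X) :=
  [/\ A B, (0 < mu B)%E &
      forall F, A F -> F `<=` B -> mu F = 0%E \/ mu F = mu B].

Definition non_atomic := forall B, ~ is_atom B.

Lemma condexp_ge0_ae (f g : X -> R) : A `<=` d.-measurable ->
  measurable_fun setT f -> measurable_fun setT g ->
  {ae mu, forall x, f x = g x} ->
  condexp_ge0 (EFin \o f) = condexp_ge0 (EFin \o g).
Proof.
move=> Am mf mg fg; congr get; apply/seteqP.
have E B : A B ->
    (\int[mu]_(x in B) (EFin \o f) x = \int[mu]_(x in B) (EFin \o g) x)%E.
  move=> /Am mB; apply: ae_eq_integral => //.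
  - exact/measurable_funTS/measurable_EFinP.
  - exact/measurable_funTS/measurable_EFinP.
  - by apply: filterS fg => x /= -> _.
split=> h /= [mh h0 hE]; split=> // B AB; rewrite -hE// E//.
Qed.

Lemma condexp_ae (f g : X -> R[i]) : A `<=` d.-measurable ->
  cmeasurable f -> cmeasurable g -> {ae mu, forall x, f x = g x} ->
  condexp f = condexp g.
Proof.
move=> Am [fR fI] [gR gI] fg; apply/funext => x.
have H (p q : X -> R) : measurable_fun setT p -> measurable_fun setT q ->
    {ae mu, forall x, p x = q x} -> condexp_real p x = condexp_real q x.
  move=> mp mq pq; rewrite /condexp_real.
  congr (fine _ - fine _); apply: (congr1 (fun h => h x)).
  - apply: condexp_ge0_ae => //; try exact: measurable_funrpos.
    by apply: filterS pq => y ->.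
  - apply: condexp_ge0_ae => //; try exact: measurable_funrneg.
    by apply: filterS pq => y ->.
by congr (_ +i* _); apply: H => //; apply: filterS fg => y ->.
Qed.

End conditional_expectation.

Section lambert.
Context d (X : measurableType d) (R : realType).
Variables (mu : {measure set X -> \bar R}) (A : set (set X)).
Variable Phi : youngFun R.

Definition lambert_multiplier (u : X -> R[i]) :=
  conditionable mu A u /\
  forall f, is_orlicz mu Phi f -> is_orlicz mu Phi (lambert_mul mu A u f).

Section operator.
Variables (u : X -> R[i]) (hu : lambert_multiplier u).

Definition lambert_fun (f : orliczFun mu Phi) : orliczFun mu Phi :=
  OrliczFun (introT (orlicz_predP mu Phi _) (hu.2 f (is_orlicz_fun f))).

(* the choice of the representative of F is irrelevant by lambert_opE *)
Definition lambert_op (F : orlicz mu Phi) : orlicz mu Phi :=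
  orlicz_class (lambert_fun (orlicz_repr F)).

Lemma lambert_opE (f : orliczFun mu Phi) : A `<=` d.-measurable ->
  lambert_op (orlicz_class f) = orlicz_class (lambert_fun f).
Proof.
move=> Am; have ff := orlicz_repr_class f; apply/orlicz_classP.
have EE : condexp mu A (orlicz_repr (orlicz_class f)) = condexp mu A f.
  apply: condexp_ae => //; last by case: (is_orlicz_fun f).
  by case: (is_orlicz_fun (orlicz_repr (orlicz_class f))).
by apply: filterS ff => x /= fx; rewrite /lambert_mul EE fx.
Qed.

End operator.
End lambert.

Section fredholm.
Context (K : numFieldType) (V W : normedModType K).

Definition spanned (U : lmodType K) n (v : 'I_n -> U) : set U :=
  range (fun c : 'I_n -> K => \sum_i c i *: v i).

(* finite_dim and finite_codim are meant for linear subspaces S *)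
Definition finite_dim (U : lmodType K) (S : set U) :=
  exists n (v : 'I_n -> U), (forall i, S (v i)) /\ S `<=` spanned v.

(* U / S is spanned by finitely many classes *)
Definition finite_codim (U : lmodType K) (S : set U) :=
  exists n (v : 'I_n -> U), forall x, exists2 s, S s & spanned v (x - s).

Definition fredholm (T : V -> W) :=
  [/\ closed (range T), finite_dim (T @^-1` [set 0]) &
      finite_codim (range T)].

End fredholm.

(* Main.v *)
(* If |E u| is not bounded below, non-atomicity provides disjoint B_k in the
   sub-sigma-algebra, of finite positive measure, with |E u| <= 8^-k on B_k.  Each
   B_k carries a nonzero f_k with T f_k = E(u) f_k, either 1_B or (u - E u) 1_B,
   which we normalize.  The series y = sum_k 2^k T f_k converges in L^Phi, so y is
   in the closed range: y = T g.  As T commutes with restriction to sets of the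
   sub-sigma-algebra, each 1_(B_k) g - 2^k f_k lies in ker T; these functions have
   disjoint supports, so by finite dimension of the kernel they vanish for
   infinitely many k, whence ||g|| >= 2^k ||f_k|| for infinitely many k, which is
   absurd.  Conditional expectations are only manipulated through their
   characterization on integrable functions, every f in L^Phi (and u itself) being
   integrable on sets of finite measure. *)

From HB Require Import structures.
Require Import Defs.
From mathcomp Require Import all_boot all_order all_algebra.
From mathcomp Require Import complex.
From mathcomp Require Import all_classical all_reals all_analysis.
From mathcomp Require Import measurable_realfun.
From mathcomp Require Import ring lra.

Import Order.TTheory GRing.Theory Num.Theory.
Import numFieldNormedType.Exports.

Set Implicit Arguments.
Unset Strict Implicit.
Unset Printing Implicit Defensive.

Local Open Scope classical_set_scope.
Local Open Scope ring_scope.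

(** * Restriction of a measure to a sub-sigma-algebra *)

Section sub_sigma_algebra.
Context d (X : measurableType d) (R : realType).
Variables (mu : {measure set X -> \bar R}) (A : set (set X)).
Hypothesis A_sigma_algebra : sigma_algebra [set: X] A.
Hypothesis A_sub : A `<=` d.-measurable.

Notation XA := (g_sigma_algebraType A).

Lemma sub_measurableE (B : set XA) : measurable B = A B.
Proof. by rewrite -[in RHS](sigma_algebra_id A_sigma_algebra). Qed.

(** The identity, seen as a map onto the coarser space. The restriction of [mu] to [A] is its
    pushforward, so integrals transfer by change of variables. *)
Definition to_sub (x : X) : XA := x.

Lemma measurable_to_sub : measurable_fun setT to_sub.
Proof.
move=> _ B mB; rewrite setTI; apply: A_sub.
by rewrite sub_measurableE in mB.
Qed.

Lemma sub_measurable_fun d' (Y : measurableType d') (g : X -> Y) :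
  measurable_fun [set: XA] g -> measurable_fun [set: X] g.
Proof. by move=> mg; exact: (measurableT_comp mg measurable_to_sub). Qed.

(** The three proofs are arguments so that the measure and sigma-finiteness instances, which depend
    on them, can be attached to this head symbol. *)
Definition sub_measure (_ : sigma_algebra [set: X] A) (_ : A `<=` d.-measurable)
    (_ : @sigma_finite _ XA R [set: X] mu) (B : set XA) : \bar R := mu B.

Section sub_measure_instance.
Hypothesis A_sigma_finite : @sigma_finite _ XA R [set: X] mu.
Local Notation muA := (sub_measure A_sigma_algebra A_sub A_sigma_finite).

Let muA0 : muA set0 = 0%E. Proof. exact: measure0. Qed.

Let muA_ge0 B : (0 <= muA B)%E. Proof. exact: measure_ge0. Qed.

Let muA_sigma_additive : semi_sigma_additive muA.
Proof.
move=> F mF tF mUF; apply: measure_semi_sigma_additive => //.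
- by move=> n; apply: A_sub; rewrite -sub_measurableE; exact: mF.
- by apply: A_sub; rewrite -sub_measurableE.
Qed.

HB.instance Definition _ := isMeasure.Build _ _ _ muA
  muA0 muA_ge0 muA_sigma_additive.

HB.instance Definition _ := @Measure_isSigmaFinite.Build _ _ _ muA A_sigma_finite.

Lemma ae_sub_measure (P : XA -> Prop) :
  {ae muA, forall x, P x} -> {ae mu, forall x : X, P x}.
Proof.
move=> [N [mN N0 PN]]; exists N; split => //.
by apply: A_sub; rewrite -sub_measurableE.
Qed.

Lemma ge0_integral_sub_measure (B : set XA) (f : XA -> \bar R) :
  A B -> measurable_fun [set: XA] f -> (forall x, 0 <= f x)%E ->
  (\int[muA]_(x in B) f x = \int[mu]_(x in (B : set X)) f x)%E.
Proof.
move=> AB mf f0.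
have := @ge0_integral_pushforward _ _ X XA R to_sub measurable_to_sub mu B f.
by rewrite sub_measurableE; apply => //; exact: measurable_funTS.
Qed.

Lemma integral_sub_measure (B : set XA) (f : XA -> \bar R) :
  A B -> measurable_fun [set: XA] f -> mu.-integrable (B : set X) f ->
  (\int[muA]_(x in B) f x = \int[mu]_(x in (B : set X)) f x)%E.
Proof.
move=> AB mf fi.
have := @integral_pushforward _ _ X XA R to_sub measurable_to_sub mu B f mf fi.
by rewrite sub_measurableE; exact.
Qed.

Lemma integrable_sub_measure (f : XA -> \bar R) :
  measurable_fun [set: XA] f -> mu.-integrable [set: X] f ->
  muA.-integrable [set: XA] f.
Proof.
move=> mf fi.
exact: (@integrable_pushforward _ _ X XA R to_sub measurable_to_sub mu setT f mf fi).
Qed.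

Lemma sub_integral_ae_eq (f g : XA -> \bar R) :
  measurable_fun [set: XA] f -> measurable_fun [set: XA] g ->
  mu.-integrable [set: X] f -> mu.-integrable [set: X] g ->
  (forall B, A B -> \int[mu]_(x in B) f x = \int[mu]_(x in B) g x)%E ->
  {ae mu, forall x, f x = g x}.
Proof.
move=> mf mg fi gi fg; apply: ae_sub_measure.
have : ae_eq muA setT f g.
  apply: integral_ae_eq => //; first exact: integrable_sub_measure.
  move=> E _; rewrite sub_measurableE => AE.
  have mE := A_sub AE.
  by rewrite !integral_sub_measure ?fg//; [exact: integrableS gi|exact: integrableS fi].
by apply: filterS => x /(_ I).
Qed.

(** Radon-Nikodym on [A]: integrating [f] defines a measure on [A], finite because [f] is
    integrable, and dominated by the restriction of [mu]. *)
Lemma is_condexp_exists_integrable (f : X -> \bar R) :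
  (forall x, 0 <= f x)%E -> mu.-integrable setT f -> exists g, is_condexp mu A f g.
Proof.
move=> f0 fi.
have mf := measurable_int _ fi.
pose nu (B : set XA) := (\int[mu]_(x in (B : set X)) f x)%E.
have nu0 : nu set0 = 0%E by rewrite /nu integral_set0.
have nu_ge0 B : (0 <= nu B)%E by exact: integral_ge0.
have nu_sa : semi_sigma_additive nu.
  move=> F mF tF mUF; apply: (semi_sigma_additive_nng_induced mf f0) => //.
  - by move=> n; apply: A_sub; rewrite -sub_measurableE; exact: mF.
  - by apply: A_sub; rewrite -sub_measurableE.
pose nuM : {measure set XA -> \bar R} :=
  HB.pack nu (isMeasure.Build _ _ _ nu nu0 nu_ge0 nu_sa).
have nu_fin : fin_num_fun nuM.
  move=> B; rewrite sub_measurableE => AB.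
  have mB := A_sub AB.
  by apply: integrable_fin_num => //; exact: integrableS fi.
pose nuF : {finite_measure set XA -> \bar R} :=
  HB.pack nu nuM (Measure_isFinite.Build _ _ _ nuM nu_fin).
have nu_dom : nuF `<< muA.
  apply/null_content_dominatesP => B; rewrite sub_measurableE => AB B0.
  rewrite /nuF /= /nu; have mB := A_sub AB.
  by apply: null_set_integral => //; exact: measurable_funTS.
have [g [g0 gfin gi gE]] := radon_nikodym_sigma_finite nu_dom.
exists g; split => //; first exact: (measurable_int muA gi).
move=> B AB; rewrite -[RHS]ge0_integral_sub_measure//; last exact: (measurable_int muA gi).
by rewrite -gE ?sub_measurableE.
Qed.

End sub_measure_instance.

End sub_sigma_algebra.

(** * Existence and uniqueness of conditional expectations *)

Section condexp_theory.
Context d (X : measurableType d) (R : realType).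
Variables (mu : {measure set X -> \bar R}) (A : set (set X)).
Hypothesis A_sigma_algebra : sigma_algebra [set: X] A.
Hypothesis A_sub : A `<=` d.-measurable.
Notation XA := (g_sigma_algebraType A).
Hypothesis A_sigma_finite : @sigma_finite _ XA R [set: X] mu.

(** A countable cover by sets of [A] of finite measure is made disjoint. The integrable case applies
    to [f] cut to each piece, and the resulting densities are summed. *)
Lemma is_condexp_exists (f : X -> \bar R) : measurable_fun setT f ->
  (forall x, 0 <= f x)%E ->
  (forall B, A B -> mu B < +oo -> \int[mu]_(x in B) f x < +oo)%E ->
  exists g, is_condexp mu A f g.
Proof.
move=> mf f0 floc; have [F TF mF] := A_sigma_finite.
have AF n : A (F n) by rewrite -sub_measurableE//; case: (mF n).
pose D : (set X)^nat := seqDU F.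
have AD n : A (D n).
  rewrite -sub_measurableE//; apply: measurableD; first by case: (mF n).
  by apply: bigsetU_measurable => i _; case: (mF i).
have mD n : d.-measurable (D n) by exact: A_sub.
have muD n : (mu (D n) < +oo)%E.
  case: (mF n) => _; apply: le_lt_trans; apply: le_measure; rewrite ?inE//.
  - exact/A_sub/AF.
  - exact: subDsetl.
pose f_ n := f \_ (D n).
have mf_ n : measurable_fun setT (f_ n).
  by apply/(measurable_restrictT _ _).1 => //; exact: measurable_funTS.
have f_0 n x : (0 <= f_ n x)%E by apply: erestrict_ge0 => //.
have fi n : mu.-integrable setT (f_ n).
  apply/integrableP; split => //.
  under eq_integral do rewrite gee0_abs//.
  by rewrite -integral_mkcond floc.
have [g_ g_P] := choice (fun n =>
  is_condexp_exists_integrable A_sigma_algebra A_sub A_sigma_finite (f_0 n) (fi n)).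
exists (fun x => \sum_(n <oo) g_ n x)%E; split.
- by apply: ge0_emeasurable_sum => [n x _ _|n _]; case: (g_P n).
- by move=> x; apply: nneseries_ge0 => n _ _; case: (g_P n).
move=> B AB; have mB := A_sub AB.
have mg_ n : measurable_fun setT (g_ n).
  by apply: (sub_measurable_fun A_sigma_algebra A_sub); case: (g_P n).
rewrite integral_nneseries//; last 2 first.
- by move=> n; exact: measurable_funTS.
- by move=> n x _; case: (g_P n).
transitivity (\sum_(n <oo) \int[mu]_(x in B) f_ n x)%E; last first.
  by apply: eq_eseriesr => n _; case: (g_P n) => _ _; exact.
rewrite -integral_nneseries//; last by move=> n; exact: measurable_funTS.
apply: eq_integral => x _.
(* The pieces are disjoint and cover the space, so at [x] only the term of the piece containing [x]
   survives. *)
have [n _ Dnx] : (\bigcup_n D n) x by rewrite -seqDU_bigcup_eq -TF.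
rewrite (@nneseriesD1 _ (f_ ^~ x) n)// eseries0 ?adde0; last first.
  move=> m _ mn; rewrite /f_ patchE ifF//; apply/negbTE/negP => /set_mem Dmx.
  by move/eqP: mn; apply; apply: (@trivIset_seqDU _ F) => //; exists x.
by rewrite /f_ patchE mem_set.
Qed.

Lemma condexp_ge0P (f : X -> \bar R) : measurable_fun setT f ->
  (forall x, 0 <= f x)%E ->
  (forall B, A B -> mu B < +oo -> \int[mu]_(x in B) f x < +oo)%E ->
  is_condexp mu A f (condexp_ge0 mu A f).
Proof. by move=> mf f0 fl; have := getPex (is_condexp_exists mf f0 fl). Qed.

(** Local integrability relative to [A]: the functions of the Orlicz space and the multiplier [u]
    need not be integrable over the whole space, but they satisfy this. *)
Definition sub_integrable (f : X -> R) := measurable_fun setT f /\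
  forall B, A B -> (mu B < +oo)%E -> mu.-integrable B (EFin \o f).

Lemma fine_condexp_ge0P (f : X -> R) : (forall x, 0 <= f x) ->
  sub_integrable f ->
  let g := condexp_ge0 mu A (EFin \o f) in
  measurable_fun [set: XA] (fine \o g) /\
  forall B, A B -> mu.-integrable B (EFin \o f) ->
    mu.-integrable B (EFin \o (fine \o g)) /\
    (\int[mu]_(x in B) (f x)%:E = \int[mu]_(x in B) (fine (g x))%:E)%E.
Proof.
move=> f0 [mf fl] g.
have [] := @condexp_ge0P (EFin \o f).
- exact/measurable_EFinP.
- by move=> x; rewrite lee_fin.
- move=> B AB Boo; have /integrableP[_] := fl _ AB Boo.
  by under eq_integral do rewrite gee0_abs ?lee_fin//.
rewrite -/g => mg g0 gE.
have mgX : measurable_fun [set: X] g := sub_measurable_fun A_sigma_algebra A_sub mg.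
split; first by apply: measurableT_comp => //; exact: measurable_fine.
move=> B AB fi; have mB := A_sub AB.
have gi : mu.-integrable B g.
  apply/integrableP; split; first exact: measurable_funTS.
  under eq_integral do rewrite gee0_abs//.
  rewrite -gE//; have /integrableP[_] := fi.
  by under eq_integral do rewrite gee0_abs ?lee_fin//.
(* [fine] sends [+oo] to 0. This is harmless on [B], where [g] is integrable and hence finite almost
   everywhere. *)
have gfin : ae_eq mu B g (EFin \o (fine \o g)).
  have := integrable_ae mB gi.
  by apply: filterS => x /= + Bx => /(_ Bx) ?; rewrite fineK.
have mg' : measurable_fun [set: X] (EFin \o (fine \o g)).
  by apply/measurable_EFinP; apply: measurableT_comp => //; exact: measurable_fine.
split; last by rewrite gE//; apply: ae_eq_integral => //; exact: measurable_funTS.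
apply: le_integrable gi => //; first exact: measurable_funTS.
by move=> x _ /=; case: (g x) => //=; rewrite normr0 leey.
Qed.

Lemma sub_integrable_max0 (f : X -> R) : sub_integrable f ->
  sub_integrable (fun x => Num.max (f x) 0).
Proof.
move=> [mf fl]; split; first exact: measurable_maxr.
move=> B AB Boo; have mB := A_sub AB.
have := integrable_funepos mB (fl _ AB Boo).
by apply: eq_integrable => // x _; rewrite funeposE/= EFin_max.
Qed.

Lemma sub_integrableN (f : X -> R) : sub_integrable f ->
  sub_integrable (fun x => - f x).
Proof.
move=> [mf fl]; split; first exact: measurableT_comp.
move=> B AB Boo; have mB := A_sub AB.
exact: (integrableN (fl _ AB Boo)).
Qed.

Lemma condexp_realP (f : X -> R) : sub_integrable f ->
  measurable_fun [set: XA] (condexp_real mu A f) /\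
  forall B, A B -> mu.-integrable B (EFin \o f) ->
    mu.-integrable B (EFin \o condexp_real mu A f) /\
    (\int[mu]_(x in B) (f x)%:E =
     \int[mu]_(x in B) (condexp_real mu A f x)%:E)%E.
Proof.
move=> fl.
have [|mp pE] := fine_condexp_ge0P _ (sub_integrable_max0 fl).
  by move=> x; rewrite le_max lexx orbT.
have [|mn nE] := fine_condexp_ge0P _ (sub_integrable_max0 (sub_integrableN fl)).
  by move=> x; rewrite le_max lexx orbT.
split; first exact: measurable_funB.
move=> B AB fi; have mB := A_sub AB.
have fpi : mu.-integrable B (EFin \o (fun x => Num.max (f x) 0)).
  have := integrable_funepos mB fi.
  by apply: eq_integrable => // x _; rewrite funeposE/= EFin_max.
have fni : mu.-integrable B (EFin \o (fun x => Num.max (- f x) 0)).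
  have := integrable_funeneg mB fi.
  by apply: eq_integrable => // x _; rewrite funenegE/= EFin_max EFinN.
have [gp gpE] := pE _ AB fpi; have [gn gnE] := nE _ AB fni.
split; first exact: (integrableB mB gp gn).
transitivity (\int[mu]_(x in B) ((Num.max (f x) 0)%R%:E - (Num.max (- f x) 0)%R%:E))%E.
  by apply: eq_integral => x _; rewrite -EFinB !maxr_absE !subr0 !addr0 normrN; congr _%:E; lra.
rewrite integralB_EFin// gpE gnE -integralB_EFin//.
Qed.

(** As [condexp_real] is built by choice, it is identified through this criterion: linearity,
    localization and idempotence below are each proved by exhibiting a candidate [h]. *)
Lemma condexp_real_unique (f h : X -> R) : measurable_fun setT f ->
  mu.-integrable setT (EFin \o f) ->
  measurable_fun [set: XA] h -> mu.-integrable setT (EFin \o h) ->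
  (forall B, A B -> \int[mu]_(x in B) (f x)%:E = \int[mu]_(x in B) (h x)%:E)%E ->
  {ae mu, forall x, condexp_real mu A f x = h x}.
Proof.
move=> mf fi mh hi fh.
have fl : sub_integrable f.
  by split => // B AB _; exact: (integrableS measurableT (A_sub AB) (@subsetT _ _) fi).
have [mE EP] := condexp_realP fl.
have AT : A setT by rewrite -sub_measurableE.
have Ei := (EP _ AT fi).1.
suff : {ae mu, forall x, (EFin \o condexp_real mu A f) x = (EFin \o h) x}.
  by apply: filterS => x /= [].
apply: (sub_integral_ae_eq A_sigma_algebra A_sub A_sigma_finite _ _ Ei hi).
- exact/measurable_EFinP.
- exact/measurable_EFinP.
move=> B AB; rewrite -fh//.
have fB := integrableS measurableT (A_sub AB) (@subsetT _ _) fi.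
by have [_ <-] := EP _ AB fB.
Qed.

End condexp_theory.

(** * Linearity and localization *)

Definition cut (T : Type) (V : nmodType) (B : set T) (f : T -> V) (x : T) : V :=
  if x \in B then f x else 0.

Lemma cut_in (T : Type) (V : nmodType) (B : set T) (f : T -> V) x :
  B x -> cut B f x = f x.
Proof. by move=> Bx; rewrite /cut mem_set. Qed.

Lemma cut_out (T : Type) (V : nmodType) (B : set T) (f : T -> V) x :
  ~ B x -> cut B f x = 0.
Proof. by move=> Bx; rewrite /cut memNset. Qed.

Section cut_real.
Context d (X : measurableType d) (R : realType).
Variables (mu : {measure set X -> \bar R}).

Lemma EFin_cut (T : Type) (B : set T) (f : T -> R) : EFin \o cut B f = (EFin \o f) \_ B.
Proof. by apply/funext => x; rewrite /= patchE /cut; case: ifP. Qed.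

Lemma measurable_cut d' (Y : measurableType d') (B : set Y) (f : Y -> R) :
  measurable B -> measurable_fun setT f -> measurable_fun setT (cut B f).
Proof.
move=> mB mf; apply/measurable_EFinP; rewrite EFin_cut.
apply/(measurable_restrictT _ _).1 => //.
by apply: measurable_funTS; exact/measurable_EFinP.
Qed.

Lemma integrable_cut (B : set X) (f : X -> R) : measurable B ->
  mu.-integrable setT (EFin \o cut B f) <-> mu.-integrable B (EFin \o f).
Proof. by move=> mB; rewrite EFin_cut; symmetry; exact: integrable_mkcond. Qed.

Lemma integral_cut (B C : set X) (f : X -> R) :
  (\int[mu]_(x in C) (cut B f x)%:E = \int[mu]_(x in C `&` B) (f x)%:E)%E.
Proof.
rewrite integral_mkcondr; apply: eq_integral => x _.
by rewrite -[LHS]/((EFin \o cut B f) x) EFin_cut.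
Qed.

End cut_real.

Section condexp_real_theory.
Context d (X : measurableType d) (R : realType).
Variables (mu : {measure set X -> \bar R}) (A : set (set X)).
Hypothesis A_sigma_algebra : sigma_algebra [set: X] A.
Hypothesis A_sub : A `<=` d.-measurable.
Notation XA := (g_sigma_algebraType A).
Hypothesis A_sigma_finite : @sigma_finite _ XA R [set: X] mu.
Local Notation condexp_real := (condexp_real mu A).
Local Notation condexp := (condexp mu A).

Let AT : A setT.
Proof. by rewrite -sub_measurableE. Qed.

Let AI B C : A B -> A C -> A (B `&` C).
Proof. by rewrite -!(sub_measurableE A_sigma_algebra); exact: measurableI. Qed.

Lemma integrable_sub_integrable (f : X -> R) : measurable_fun setT f ->
  mu.-integrable setT (EFin \o f) -> sub_integrable mu A f.
Proof.
move=> mf fi; split => // B AB _.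
exact: (integrableS measurableT (A_sub AB) (@subsetT _ _) fi).
Qed.

Lemma condexp_real_id (h : X -> R) : measurable_fun [set: XA] h ->
  mu.-integrable setT (EFin \o h) -> {ae mu, forall x, condexp_real h x = h x}.
Proof.
move=> mh hi; apply: (condexp_real_unique A_sigma_algebra) => //.
exact: (sub_measurable_fun A_sigma_algebra).
Qed.

Lemma condexp_real_linear (a : R) (f g : X -> R) :
  measurable_fun setT f -> mu.-integrable setT (EFin \o f) ->
  measurable_fun setT g -> mu.-integrable setT (EFin \o g) ->
  {ae mu, forall x, condexp_real (fun y => a * f y + g y) x =
                    a * condexp_real f x + condexp_real g x}.
Proof.
move=> mf fi mg gi.
have [mEf Ef] := condexp_realP A_sigma_algebra A_sub A_sigma_finite
  (integrable_sub_integrable mf fi).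
have [mEg Eg] := condexp_realP A_sigma_algebra A_sub A_sigma_finite
  (integrable_sub_integrable mg gi).
have iB B (h : X -> R) : A B -> mu.-integrable setT (EFin \o h) ->
    mu.-integrable B (EFin \o h).
  by move=> AB; apply: integrableS => //; exact: A_sub.
have iZ B (h : X -> R) : mu.-integrable B (EFin \o h) -> measurable B ->
    mu.-integrable B (EFin \o (fun x => a * h x)).
  by move=> hi mB; exact: (integrableZl mB a hi).
apply: (condexp_real_unique A_sigma_algebra) => //.
- by apply: measurable_funD => //; exact: measurable_funM.
- exact: (integrableD measurableT (iZ _ _ fi measurableT) gi).
- by apply: measurable_funD => //; exact: measurable_funM.
- exact: (integrableD measurableT (iZ _ _ (Ef _ AT fi).1 measurableT) (Eg _ AT gi).1).
move=> B AB; have mB := A_sub AB.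
have [Ef1 Ef2] := Ef _ AB (iB _ _ AB fi).
have [Eg1 Eg2] := Eg _ AB (iB _ _ AB gi).
rewrite (integralD_EFin mB (iZ _ _ (iB _ _ AB fi) mB) (iB _ _ AB gi)).
rewrite (integralD_EFin mB (iZ _ _ Ef1 mB) Eg1) Eg2; congr (_ + _)%E.
have ZE (h : X -> R) : mu.-integrable B (EFin \o h) ->
    (\int[mu]_(x in B) (a * h x)%:E = a%:E * \int[mu]_(x in B) (h x)%:E)%E.
  by move=> hi; rewrite -integralZl.
transitivity (a%:E * \int[mu]_(x in B) (f x)%:E)%E; first exact/ZE/iB.
by rewrite Ef2; symmetry; exact: ZE.
Qed.

(** Since [B] is in [A], the function [cut B (condexp_real f)] is [A]-measurable, and testing it on
    [C] amounts to testing [condexp_real f] on the intersection of [C] and [B]. Cutting also gives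
    the global integrability that uniqueness requires when [f] is only locally integrable. *)
Lemma condexp_real_cut (f : X -> R) (B : set X) : sub_integrable mu A f ->
  A B -> mu.-integrable B (EFin \o f) ->
  {ae mu, forall x, condexp_real (cut B f) x = cut B (condexp_real f) x}.
Proof.
move=> fl AB fi; have mB := A_sub AB; have [mf _] := fl.
have [mEf Ef] := condexp_realP A_sigma_algebra A_sub A_sigma_finite fl.
apply: (condexp_real_unique A_sigma_algebra) => //.
- exact: measurable_cut.
- exact/integrable_cut.
- by apply: measurable_cut => //; rewrite sub_measurableE.
- by apply/integrable_cut => //; case: (Ef _ AB fi).
move=> C AC; rewrite !integral_cut.
have [] // := Ef _ (AI AC AB).
by apply: integrableS fi => //; apply: measurableI => //; exact: A_sub.
Qed.

(** * Conditional expectation and Lambert product of complex functions *)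

Definition cintegrable (D : set X) (f : X -> R[i]) :=
  mu.-integrable D (EFin \o (fun x => complex.Re (f x))) /\
  mu.-integrable D (EFin \o (fun x => complex.Im (f x))).

Definition csub_integrable (f : X -> R[i]) :=
  sub_integrable mu A (fun x => complex.Re (f x)) /\
  sub_integrable mu A (fun x => complex.Im (f x)).

Definition csub_measurable (f : X -> R[i]) :=
  measurable_fun [set: XA] (fun x => complex.Re (f x)) /\
  measurable_fun [set: XA] (fun x => complex.Im (f x)).

Lemma csub_measurableW f : csub_measurable f -> cmeasurable f.
Proof. by move=> [fR fI]; split; apply: (sub_measurable_fun A_sigma_algebra). Qed.

Lemma csub_integrableW f : csub_integrable f -> cmeasurable f.
Proof. by case=> [[? _] [? _]]. Qed.

Lemma csub_integrable_on f B : csub_integrable f -> A B -> (mu B < +oo)%E ->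
  cintegrable B f.
Proof. by move=> [[_ fR] [_ fI]] AB Boo; split; [exact: fR|exact: fI]. Qed.

Lemma condexp_csub_measurable f : csub_integrable f -> csub_measurable (condexp f).
Proof.
move=> [fR fI]; split.
- by have [] := condexp_realP A_sigma_algebra A_sub A_sigma_finite fR.
- by have [] := condexp_realP A_sigma_algebra A_sub A_sigma_finite fI.
Qed.

Lemma Re_cut B (f : X -> R[i]) :
  (fun x => complex.Re (cut B f x)) = cut B (fun x => complex.Re (f x)).
Proof. by apply/funext => x; rewrite /cut; case: ifP. Qed.

Lemma Im_cut B (f : X -> R[i]) :
  (fun x => complex.Im (cut B f x)) = cut B (fun x => complex.Im (f x)).
Proof. by apply/funext => x; rewrite /cut; case: ifP. Qed.

Lemma cmeasurable_cut B (f : X -> R[i]) : measurable B -> cmeasurable f ->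
  cmeasurable (cut B f).
Proof. by move=> mB [fR fI]; split; rewrite (Re_cut, Im_cut); exact: measurable_cut. Qed.

Lemma csub_measurable_cut B (f : X -> R[i]) : A B -> csub_measurable f ->
  csub_measurable (cut B f).
Proof.
move=> AB [fR fI]; split; rewrite (Re_cut, Im_cut); apply: measurable_cut => //;
  by rewrite sub_measurableE.
Qed.

Lemma cintegrable_cut B (f : X -> R[i]) : measurable B -> cintegrable B f ->
  cintegrable setT (cut B f).
Proof.
by move=> mB [fR fI]; split; rewrite (Re_cut, Im_cut); apply/integrable_cut.
Qed.

Lemma cintegrable_condexp f B : csub_integrable f -> A B -> (mu B < +oo)%E ->
  cintegrable B (condexp f).
Proof.
move=> [fR fI] AB Boo; split.
- have [_ /(_ B AB) []//] := condexp_realP A_sigma_algebra A_sub A_sigma_finite fR.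
  by case: fR => _; exact.
- have [_ /(_ B AB) []//] := condexp_realP A_sigma_algebra A_sub A_sigma_finite fI.
  by case: fI => _; exact.
Qed.

Lemma condexp_cut (f : X -> R[i]) (B : set X) : csub_integrable f ->
  A B -> (mu B < +oo)%E ->
  {ae mu, forall x, condexp (cut B f) x = cut B (condexp f) x}.
Proof.
move=> [fR fI] AB Boo.
have hR := condexp_real_cut fR AB (fR.2 _ AB Boo).
have hI := condexp_real_cut fI AB (fI.2 _ AB Boo).
apply: filterS2 hR hI => x.
rewrite -Re_cut -Im_cut /Defs.condexp => -> ->.
by rewrite /cut; case: ifP.
Qed.

Lemma condexp_id (h : X -> R[i]) : csub_measurable h -> cintegrable setT h ->
  {ae mu, forall x, condexp h x = h x}.
Proof.
move=> [mR mI] [iR iI].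
apply: filterS2 (condexp_real_id mR iR) (condexp_real_id mI iI) => x.
by rewrite /Defs.condexp => -> ->; case: (h x).
Qed.

(** A real scalar acts separately on real and imaginary parts, which reduces the claim to the real
    case. Signs, normalizing constants and the factors [2 ^+ k] are all real. *)
Lemma condexp_linear (a : R) (f g : X -> R[i]) : cmeasurable f -> cmeasurable g ->
  cintegrable setT f -> cintegrable setT g ->
  {ae mu, forall x, condexp (a%:C%C *: f + g) x =
                    a%:C%C * condexp f x + condexp g x}.
Proof.
move=> [mfR mfI] [mgR mgI] [fR fI] [gR gI].
apply: filterS2 (condexp_real_linear a mfR fR mgR gR)
  (condexp_real_linear a mfI fI mgI gI) => x.
rewrite /Defs.condexp => hR hI.
rewrite (_ : (fun y => complex.Re ((a%:C%C *: f + g) y)) =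
  (fun y => a * complex.Re (f y) + complex.Re (g y))); last first.
  apply/funext => y; rewrite !fctE; case: (f y); case: (g y) => p q r s /=.
  by rewrite mul0r subr0.
rewrite (_ : (fun y => complex.Im ((a%:C%C *: f + g) y)) =
  (fun y => a * complex.Im (f y) + complex.Im (g y))); last first.
  apply/funext => y; rewrite !fctE; case: (f y); case: (g y) => p q r s /=.
  by rewrite mul0r addr0.
rewrite hR hI; apply/eqP; rewrite eq_complex /=.
by rewrite !mul0r subr0 addr0 !eqxx.
Qed.

Lemma condexpB (f g : X -> R[i]) : cmeasurable f -> cmeasurable g ->
  cintegrable setT f -> cintegrable setT g ->
  {ae mu, forall x, condexp (f - g) x = condexp f x - condexp g x}.
Proof.
move=> mf mg fi gi; apply: filterS (condexp_linear (-1) mg mf gi fi) => x.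
rewrite rmorphN rmorph1 scaleN1r addrC => ->; ring.
Qed.

(** By localization and idempotence both terms have conditional expectation [cut B (condexp f)]. *)
Lemma condexp_centered (f : X -> R[i]) (B : set X) : csub_integrable f ->
  A B -> (mu B < +oo)%E ->
  {ae mu, forall x, condexp (cut B f - cut B (condexp f)) x = 0}.
Proof.
move=> fl AB Boo; have mB := A_sub AB.
have mE := csub_measurable_cut AB (condexp_csub_measurable fl).
have iE := cintegrable_cut mB (cintegrable_condexp fl AB Boo).
have := condexpB (cmeasurable_cut mB (csub_integrableW fl)) (csub_measurableW mE)
  (cintegrable_cut mB (csub_integrable_on fl AB Boo)) iE.
apply: filterS3 (condexp_cut fl AB Boo) (condexp_id mE iE) => x + + ->.
by move=> -> ->; rewrite subrr.
Qed.

(** Every term of the product contains either [f] or its conditional expectation as a factor, and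
    both are multiplied by the indicator of [B]. *)
Lemma lambert_mul_cut u (f : X -> R[i]) (B : set X) : csub_integrable f ->
  A B -> (mu B < +oo)%E ->
  {ae mu, forall x, lambert_mul mu A u (cut B f) x = cut B (lambert_mul mu A u f) x}.
Proof.
move=> fl AB Boo; apply: filterS (condexp_cut fl AB Boo) => x.
rewrite /lambert_mul /cut => ->; case: ifP => // _.
by rewrite mulr0 mul0r mulr0 addr0 subr0.
Qed.

Lemma lambert_mul_linear u (a : R) (f g : X -> R[i]) :
  cmeasurable f -> cmeasurable g -> cintegrable setT f -> cintegrable setT g ->
  {ae mu, forall x, lambert_mul mu A u (a%:C%C *: f + g) x =
    a%:C%C * lambert_mul mu A u f x + lambert_mul mu A u g x}.
Proof.
move=> mf mg fi gi; apply: filterS (condexp_linear a mf mg fi gi) => x.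
rewrite /lambert_mul => ->; rewrite !fctE.
rewrite (_ : a%:C%C *: f x = a%:C%C * f x)//; ring.
Qed.

End condexp_real_theory.

(** * Orlicz functions *)

Section orlicz_lemmas.
Context d (X : measurableType d) (R : realType).
Variables (mu : {measure set X -> \bar R}) (Phi : youngFun R).
Implicit Types f g : X -> R[i].

Lemma normc_ge0 (z : R[i]) : 0 <= normc z.
Proof. by case: z => x y; exact: sqrtr_ge0. Qed.

Lemma ler_Re_normc (z : R[i]) : `|complex.Re z| <= normc z.
Proof. by case: z => x y /=; rewrite -sqrtr_sqr ler_wsqrtr// lerDl sqr_ge0. Qed.

Lemma ler_Im_normc (z : R[i]) : `|complex.Im z| <= normc z.
Proof. by case: z => x y /=; rewrite -sqrtr_sqr ler_wsqrtr// lerDr sqr_ge0. Qed.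

Lemma normc_real (r : R) : normc r%:C%C = `|r|.
Proof. by rewrite /= expr0n addr0 sqrtr_sqr. Qed.

(** Choose [y] with [1 <= Phi y]. For [t] beyond [y], convexity and [Phi 0 = 0] give
    [1 <= Phi y <= y / t * Phi t], that is [t <= y * Phi t]; otherwise [t <= y]. Hence [y] serves as
    [M]. *)
Lemma young_linear_bound :
  exists2 M : R, 0 < M & forall t, 0 <= t -> t <= M + M * Phi t.
Proof.
have /cvgryPge /(_ 1) [M [_ MP]] := @young_cvgy _ Phi.
pose y := Num.max M 0 + 1.
have M0 : 0 <= Num.max M 0 by rewrite le_max lexx orbT.
have y0 : 0 < y by rewrite ltr_wpDl.
have Py : 1 <= Phi y.
  by apply: MP; rewrite /y (@le_lt_trans _ _ (Num.max M 0)) ?ltrDl// le_max lexx.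
exists y => // t t0; have [ty|yt] := leP t y.
  by rewrite (le_trans ty)// lerDl mulr_ge0 ?young_ge0// ltW.
have tp : 0 < t by exact: lt_trans yt.
have yt01 : 0 <= y / t <= 1.
  by rewrite divr_ge0 ?(ltW y0)//= ler_pdivrMr// mul1r ltW.
have := le_trans Py (_ : Phi y <= y / t * Phi t).
rewrite -{1}(divfK (lt0r_neq0 tp) y) young_scale// => /(_ isT).
rewrite mulrAC ler_pdivlMr// mul1r => /le_trans; apply.
by rewrite lerDr ltW.
Qed.

(** The linear bound at [c * normc (f x)] dominates the function by a constant, integrable on a set
    of finite measure, plus a multiple of the integrable [Phi (c * normc (f x))]. *)
Lemma is_orlicz_cintegrable f B : is_orlicz mu Phi f -> measurable B ->
  (mu B < +oo)%E -> cintegrable mu B f.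
Proof.
move=> [mf [c c0 fc]] mB Boo.
have [M M0 MP] := young_linear_bound.
have mPhi := @measurable_Phi _ _ _ Phi c f mf.
have hi : mu.-integrable B
    (fun x => c^-1%:E * (M%:E + M%:E * (Phi (c * normc (f x)))%:E))%E.
  apply: integrableZl => //; apply: integrableD => //.
    apply/integrableP; split; first exact: measurable_cst.
    by rewrite integral_cst// lte_mul_pinfty.
  apply: integrableZl => //; apply/integrableP; split.
    exact: measurable_funTS.
  apply: le_lt_trans fc; under eq_integral do rewrite gee0_abs ?lee_fin ?young_ge0//.
  by apply: ge0_subset_integral => // x _; rewrite lee_fin young_ge0.
have H x : normc (f x) <= c^-1 * (M + M * Phi (c * normc (f x))).
  by rewrite ler_pdivlMl// MP// mulr_ge0 ?normc_ge0 ?ltW.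
have [mR mI] := mf.
split; apply: le_integrable hi => //.
- by apply: measurable_funTS; exact/measurable_EFinP.
- move=> x _; rewrite /= lee_fin.
  by rewrite (le_trans (ler_Re_normc _))// (le_trans (H x))// ler_norm.
- by apply: measurable_funTS; exact/measurable_EFinP.
- move=> x _; rewrite /= lee_fin.
  by rewrite (le_trans (ler_Im_normc _))// (le_trans (H x))// ler_norm.
Qed.

Lemma is_orlicz_ae f g : cmeasurable g -> is_orlicz mu Phi f ->
  {ae mu, forall x, f x = g x} -> is_orlicz mu Phi g.
Proof.
move=> mg [mf [c c0 fc]] fg; split => //; exists c => //.
by rewrite -(Phi_integral_ae Phi c mf mg fg).
Qed.

Lemma Phi_integral_mono c f g : 0 <= c -> cmeasurable f -> cmeasurable g ->
  (forall x, normc (g x) <= normc (f x)) ->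
  (Phi_integral mu Phi c g <= Phi_integral mu Phi c f)%E.
Proof.
move=> c0 mf mg gf; apply: ge0_le_integral => //.
- by move=> x _; rewrite lee_fin young_ge0.
- exact: measurable_Phi.
- exact: measurable_Phi.
- move=> x _; rewrite lee_fin young_le// ?mulr_ge0 ?normc_ge0//.
  by rewrite ler_wpM2l.
Qed.

Lemma is_orlicz_le f g : cmeasurable g -> is_orlicz mu Phi f ->
  (forall x, normc (g x) <= normc (f x)) -> is_orlicz mu Phi g.
Proof.
move=> mg [mf [c c0 fc]] gf; split => //; exists c => //.
by apply: le_lt_trans fc; apply: Phi_integral_mono => //; exact: ltW.
Qed.

Lemma le_luxemburg f g : cmeasurable g -> is_orlicz mu Phi f ->
  (forall x, normc (g x) <= normc (f x)) ->
  luxemburg mu Phi g <= luxemburg mu Phi f.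
Proof.
move=> mg of_ gf; have [fn0 _] := luxemburg_has_inf of_.
apply: lb_le_inf => // c [c0 fc].
apply: luxemburg_le => //; first exact: is_orlicz_le of_ gf.
by apply: le_trans fc; apply: Phi_integral_mono => //; [rewrite invr_ge0 ltW|case: of_].
Qed.

Lemma is_orlicz_cut f B : measurable B -> is_orlicz mu Phi f ->
  is_orlicz mu Phi (cut B f).
Proof.
move=> mB of_; apply: is_orlicz_le (of_) _.
  by apply: cmeasurable_cut => //; case: of_.
move=> x; rewrite /cut; case: ifP => // _.
by rewrite ComplexField.Normc.normc0 normc_ge0.
Qed.

Lemma luxemburg_cut f B : measurable B -> is_orlicz mu Phi f ->
  luxemburg mu Phi (cut B f) <= luxemburg mu Phi f.
Proof.
move=> mB of_; apply: le_luxemburg (of_) _.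
  by apply: cmeasurable_cut => //; case: of_.
move=> x; rewrite /cut; case: ifP => // _.
by rewrite ComplexField.Normc.normc0 normc_ge0.
Qed.

Lemma is_orlicz_cut1 B : measurable B -> (mu B < +oo)%E ->
  is_orlicz mu Phi (cut B (fun=> 1)).
Proof.
move=> mB Boo; split.
  by apply: cmeasurable_cut => //; split; exact: measurable_cst.
exists 1 => //; rewrite /Phi_integral.
rewrite (eq_integral (fun x => ((fun=> (Phi 1)%:E) \_ B) x)); last first.
  move=> x _; rewrite patchE /cut; case: ifP => _.
    by rewrite mul1r /= expr0n addr0 expr1n sqrtr1.
  by rewrite ComplexField.Normc.normc0 mulr0 young0.
rewrite -integral_mkcond integral_cst//.
by rewrite lte_mul_pinfty// lee_fin young_ge0.
Qed.

Lemma is_orlicz_cut_bounded B f (M : R) : measurable B -> (mu B < +oo)%E ->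
  cmeasurable f -> (forall x, B x -> normc (f x) <= M) ->
  is_orlicz mu Phi (cut B f).
Proof.
move=> mB Boo mf fM.
apply: is_orlicz_le (is_orliczZ M%:C%C (is_orlicz_cut1 mB Boo)) _.
  exact: cmeasurable_cut.
move=> x; rewrite fctE /cut; case: ifPn => [/set_mem Bx|_].
  have -> : normc (M%:C%C *: (1 : R[i])) = normc M%:C%C * normc (1 : R[i]).
    exact: ComplexField.Normc.normcM.
  by rewrite normc_real /= expr0n addr0 expr1n sqrtr1 mulr1 (le_trans (fM _ Bx))// ler_norm.
by rewrite ComplexField.Normc.normc0 normc_ge0.
Qed.

End orlicz_lemmas.

(** * Small sets in a non-atomic space *)

Section non_atomic_lemmas.
Context d (X : measurableType d) (R : realType).
Variables (mu : {measure set X -> \bar R}) (A : set (set X)).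
Hypothesis A_sigma_algebra : sigma_algebra [set: X] A.
Hypothesis A_sub : A `<=` d.-measurable.
Notation XA := (g_sigma_algebraType A).
Hypothesis A_sigma_finite : @sigma_finite _ XA R [set: X] mu.
Hypothesis A_non_atomic : non_atomic mu A.

Let AD B C : A B -> A C -> A (B `\` C).
Proof. by rewrite -!(sub_measurableE A_sigma_algebra); exact: measurableD. Qed.

Let AI B C : A B -> A C -> A (B `&` C).
Proof. by rewrite -!(sub_measurableE A_sigma_algebra); exact: measurableI. Qed.

Let Abig (F : nat -> set X) : (forall i, A (F i)) -> A (\bigcup_i F i).
Proof.
move=> AF; rewrite -(sub_measurableE A_sigma_algebra); apply: bigcupT_measurable.
by move=> i; rewrite (sub_measurableE A_sigma_algebra).
Qed.

Lemma sub_finite_subset S : A S -> (0 < mu S)%E ->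
  exists C, [/\ A C, C `<=` S, (0 < mu C)%E & (mu C < +oo)%E].
Proof.
move=> AS S0; have [F TF mF] := A_sigma_finite.
have AF n : A (F n) by rewrite -sub_measurableE//; case: (mF n).
apply: contrapT => H.
suff S00 : mu S = 0%E by rewrite S00 ltxx in S0.
apply/eqP; rewrite -measure_le0.
have -> : S = \bigcup_n (S `&` F n) by rewrite -setI_bigcupr -TF setIT.
have mSF n : measurable (S `&` F n) by exact/A_sub/AI.
have sub : (mu (\bigcup_n (S `&` F n)) <= \sum_(n <oo) mu (S `&` F n))%E.
  by apply: measure_sigma_subadditive => //; exact: bigcupT_measurable.
apply: (le_trans sub); rewrite eseries0// => n _ _; apply: contrapT => /eqP n0; apply: H.
exists (S `&` F n); split => //.
- exact: AI.
- by rewrite lt0e n0 measure_ge0.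
- case: (mF n) => _; apply: le_lt_trans; apply: le_measure; rewrite ?inE//.
  exact/A_sub/AF.
Qed.

(** As [S] is not an atom, it contains some [F] in [A] of measure neither 0 nor that of [S]; the
    smaller of [F] and its complement in [S] will do. *)
Lemma non_atomic_half S : A S -> (0 < mu S)%E -> (mu S < +oo)%E ->
  exists C, [/\ A C, C `<=` S, (0 < mu C)%E & (mu C + mu C <= mu S)%E].
Proof.
move=> AS S0 Soo.
have [F [AF FS F0 FnS]] : exists F, [/\ A F, F `<=` S, mu F <> 0%E & mu F <> mu S].
  apply: contrapT => H; apply: (A_non_atomic (B := S)); split => // F AF FS.
  have [F0|F0] := eqVneq (mu F) 0%E; [by left|right].
  by apply: contrapT => FnS; apply: H; exists F; split => //; exact/eqP.
have mS := A_sub AS; have mF := A_sub AF.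
have FlS : (mu F <= mu S)%E by apply: le_measure; rewrite ?inE.
have SE : mu S = (mu F + mu (S `\` F))%E.
  rewrite -measureU//; first by rewrite setDUK.
  - exact: measurableD.
  - by rewrite setDE setICA setICr setI0.
have Foo : (mu F < +oo)%E by exact: le_lt_trans Soo.
have D0 : (0 < mu (S `\` F))%E.
  rewrite lt0e measure_ge0 andbT; apply/eqP => D0.
  by apply: FnS; rewrite SE D0 adde0.
have [le|lt] := leP (mu F) (mu (S `\` F)).
- exists F; split => //; first by rewrite lt0e measure_ge0 andbT; exact/eqP.
  by rewrite [leRHS]SE leeD2l.
- exists (S `\` F); split => //; first exact: AD.
  by rewrite [leRHS]SE leeD2r// ltW.
Qed.

Lemma non_atomic_small S (e : R) : A S -> (0 < mu S)%E -> 0 < e ->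
  exists C, [/\ A C, C `<=` S, (0 < mu C)%E & (mu C <= e%:E)%E].
Proof.
move=> AS S0 e0.
have [D [AD' DS D0 Doo]] := sub_finite_subset AS S0.
have H n : exists C, [/\ A C, C `<=` D, (0 < mu C)%E &
    ((2 ^+ n)%:E * mu C <= mu D)%E].
  elim: n => [|n [C [AC CD C0 CE]]].
    by exists D; split => //; rewrite expr0 mul1e.
  have Coo : (mu C < +oo)%E.
    apply: le_lt_trans Doo; apply: le_measure; rewrite ?inE//; exact: A_sub.
  have [C' [AC' C'C C'0 C'E]] := non_atomic_half AC C0 Coo.
  exists C'; split => //; first exact: subset_trans CD.
  apply: le_trans CE; rewrite exprSr EFinM -muleA lee_wpmul2l//.
  by rewrite (_ : 2%:E = 1 + 1)%E ?ge0_muleDl ?mul1e.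
pose r := fine (mu D).
have rE : mu D = r%:E by rewrite fineK// ge0_fin_numE.
(* [Num.bound (r / e)] exceeds [r / e], and [2 ^+ n] exceeds [n], so this many halvings bring the
   measure down to [e]. *)
have [C [AC CD C0 CE]] := H (Num.bound (r / e)).
exists C; split => //; first exact: subset_trans DS.
have r0 : 0 <= r by rewrite fine_ge0.
have p0 : 0 < 2 ^+ Num.bound (r / e) :> R by exact: exprn_gt0.
have Coo : (mu C < +oo)%E.
  apply: le_lt_trans Doo; apply: le_measure; rewrite ?inE//; exact: A_sub.
have cE : mu C = (fine (mu C))%:E by rewrite fineK// ge0_fin_numE.
rewrite cE lee_fin; move: CE; rewrite cE rE -EFinM lee_fin => CE.
rewrite -(ler_pM2l p0) (le_trans CE)// -ler_pdivrMr//.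
rewrite (le_trans (ltW (archi_boundP _)))// ?divr_ge0 ?(ltW e0)//.
by rewrite -natrX ler_nat ltnW// ltn_expl.
Qed.

(** The [S k] may be nested, so disjointness has to be created: choose [C k] inside [S k] with
    measures dropping by a factor 4 at each stage, then remove from [C k] the union [U k] of all
    later sets, which is too small to exhaust it. *)
Lemma non_atomic_disjoint (S : nat -> set X) :
  (forall k, A (S k)) -> (forall k, 0 < mu (S k))%E ->
  exists B : nat -> set X, [/\ forall k, A (B k), forall k, B k `<=` S k,
    forall k, (0 < mu (B k) < +oo)%E & trivIset setT B].
Proof.
move=> AS S0.
(* The pair holds the index of the new set and the set chosen before it. The conditions on the
   latter stay under the existential, with [set0] as dummy witness, because [choice] needs a total
   relation. *)
have next_ex (p : nat * set X) : exists C, A p.2 -> (0 < mu p.2 < +oo)%E ->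
    [/\ A C, C `<=` S p.1, (0 < mu C < +oo)%E & (mu C <= (fine (mu p.2) / 4)%:E)%E].
  move: p => [k D] /=.
  have [[AD' /andP[D0 Doo]]|H] := pselect (A D /\ (0 < mu D < +oo)%E); last first.
    by exists set0 => *; exfalso; exact: H.
  have fD : 0 < fine (mu D) / 4 by rewrite divr_gt0// fine_gt0// D0.
  have [C [AC CS C0 CE]] := non_atomic_small (AS k) (S0 k) fD.
  by exists C => _ _; split => //; rewrite C0 (le_lt_trans CE)// ltry.
have [nx nxP] := choice next_ex.
have [C0 [AC0 C0S C00 C0oo]] := sub_finite_subset (AS 0%N) (S0 0%N).
pose C := fix C n := if n is m.+1 then nx (n, C m) else C0.
have CP n : [/\ A (C n), C n `<=` S n & (0 < mu (C n) < +oo)%E].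
  elim: n => [|n [ACn _ Cn]]; first by rewrite /= C00.
  by have [] := nxP (n.+1, C n) ACn Cn.
have CS n : (mu (C n.+1) <= (fine (mu (C n)) / 4)%:E)%E.
  by have [ACn _ Cn] := CP n; have [] := nxP (n.+1, C n) ACn Cn.
pose c n := fine (mu (C n)).
have cE n : mu (C n) = (c n)%:E.
  by rewrite /c fineK// ge0_fin_numE//; have [_ _ /andP[]] := CP n.
have c0 n : 0 < c n by rewrite /c fine_gt0//; have [] := CP n.
have cS n : c n.+1 <= c n / 4 by rewrite -lee_fin -cE; exact: CS.
(* Weaker than the decay by powers of 4, but in the form whose series [epsilon_trick0] bounds by
   [c k / 2]. *)
have cSj k j : c (k.+1 + j)%N <= (c k / 2) / (2 ^ j.+1)%:R.
  elim: j => [|j IH]; first by rewrite addn0 expn1 (le_trans (cS _))//; have := c0 k; lra.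
  rewrite addnS (le_trans (cS _))// expnS natrM invfM.
  rewrite (le_trans (ler_wpM2r _ IH))//.
  set q := (2 ^ j.+1)%:R^-1; have q0 : 0 <= q by rewrite invr_ge0.
  have := c0 k; nra.
pose U k := \bigcup_j C (k.+1 + j)%N.
have AC n : A (C n) by have [] := CP n.
have AU k : A (U k) by exact: Abig.
have mC n : measurable (C n) by exact/A_sub.
have UC k : (mu (U k) <= (c k / 2)%:E)%E.
  have sub : (mu (U k) <= \sum_(j <oo) mu (C (k.+1 + j)%N))%E.
    by apply: measure_sigma_subadditive => //; exact: A_sub.
  apply: (le_trans sub); apply: (@le_trans _ _ (\sum_(j <oo) ((c k / 2) / (2 ^ j.+1)%:R)%:E)%E).
    by apply: lee_nneseries => j _ //; rewrite cE lee_fin cSj.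
  apply: epsilon_trick0; first by rewrite divr_ge0// ltW.
exists (fun k => C k `\` U k); split.
- by move=> k; exact: AD.
- by move=> k x [Cx _]; have [_ + _] := CP k; exact.
- move=> k; have mU := A_sub (AU k).
  have DC : (mu (C k `\` U k) <= mu (C k))%E.
    by apply: le_measure; rewrite ?inE//; exact: measurableD.
  have [_ _ /andP[_ Coo]] := CP k.
  rewrite (le_lt_trans DC Coo) andbT lt0e measure_ge0 andbT; apply/eqP => D0.
  (* If nothing but a null set were left of [C k], its measure would be at most that of [U k], half
     of its own. *)
  have : (mu (C k) <= (c k / 2)%:E)%E.
    have CE : mu (C k) = (mu (C k `\` U k) + mu (C k `&` U k))%E.
      exact: measureDI.
    have {}D0 : mu (C k `\` U k) = 0%E by exact: D0.
    rewrite CE D0 add0e.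
    rewrite (le_trans _ (UC k))//.
    by apply: le_measure; rewrite ?inE//; exact: measurableI.
  by rewrite cE lee_fin; have := c0 k; lra.
- suff H i j x : (i < j)%N -> (C i `\` U i) x -> (C j `\` U j) x -> False.
    move=> i j _ _ [x [Bi Bj]]; case: (ltngtP i j) => // ij; exfalso.
      exact: (H _ _ x ij).
    exact: (H _ _ x ij).
  move=> ij [_ Uix] [Cjx _]; apply: Uix; exists (j - i.+1)%N => //.
  by rewrite subnKC.
Qed.

End non_atomic_lemmas.

(** * Approximate eigenfunctions of a Lambert multiplication *)

Section multiplier.
Context d (X : measurableType d) (R : realType).
Variables (mu : {measure set X -> \bar R}) (A : set (set X)) (Phi : youngFun R).
Hypothesis A_sigma_algebra : sigma_algebra [set: X] A.
Hypothesis A_sub : A `<=` d.-measurable.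
Notation XA := (g_sigma_algebraType A).
Hypothesis A_sigma_finite : @sigma_finite _ XA R [set: X] mu.
Variable u : X -> R[i].
Hypothesis u_multiplier : lambert_multiplier mu A Phi u.
Local Notation Eu := (condexp mu A u).
Local Notation mulu := (lambert_mul mu A u).

Let mu_u : cmeasurable u. Proof. by case: u_multiplier => [[]]. Qed.

Lemma is_orlicz_csub_integrable f : is_orlicz mu Phi f -> csub_integrable mu A f.
Proof.
move=> of_; have [[mR mI] _] := of_.
split; split => // B AB Boo;
  by have [] := is_orlicz_cintegrable of_ (A_sub AB) Boo.
Qed.

(** The indicator of [B] is [A]-measurable and integrable, hence its own conditional expectation,
    and the two terms containing [Eu] cancel. *)
Lemma lambert_mul_cut1 B : A B -> (mu B < +oo)%E ->
  {ae mu, forall x, mulu (cut B (fun=> 1)) x = cut B u x}.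
Proof.
move=> AB Boo; have mB := A_sub AB.
have m1 : csub_measurable A (cut B (fun=> 1 : R[i])).
  by apply: (csub_measurable_cut A_sigma_algebra) => //; split; exact: measurable_cst.
have i1 : cintegrable mu setT (cut B (fun=> 1 : R[i])).
  apply: cintegrable_cut => //.
  have := is_orlicz_cintegrable (is_orlicz_cut1 Phi mB Boo) mB Boo.
  move=> [iR iI]; split; [apply: eq_integrable iR|apply: eq_integrable iI] => // x Bx;
    by rewrite /= cut_in//; exact: set_mem.
have := condexp_id A_sigma_algebra A_sub A_sigma_finite m1 i1.
apply: filterS => x; rewrite /lambert_mul => ->; rewrite /cut; case: ifP => _; ring.
Qed.

Lemma is_orlicz_cut_multiplier B : A B -> (mu B < +oo)%E ->
  is_orlicz mu Phi (cut B u).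
Proof.
move=> AB Boo; have mB := A_sub AB.
apply: is_orlicz_ae (u_multiplier.2 _ (is_orlicz_cut1 Phi mB Boo)) (lambert_mul_cut1 AB Boo).
exact: cmeasurable_cut.
Qed.

(** The multiplier property applied to indicators puts [cut B u] in the Orlicz space, whence [u] is
    integrable on every [B] in [A] of finite measure. *)
Lemma multiplier_csub_integrable : csub_integrable mu A u.
Proof.
have [mR mI] := mu_u.
split; split => // B AB Boo; have mB := A_sub AB;
  have [iR iI] := is_orlicz_cintegrable (is_orlicz_cut_multiplier AB Boo) mB Boo.
- by apply: eq_integrable iR => // x Bx; rewrite /= cut_in//; exact: set_mem.
- by apply: eq_integrable iI => // x Bx; rewrite /= cut_in//; exact: set_mem.
Qed.

Let u_loc := multiplier_csub_integrable.

Lemma Eu_csub_measurable : csub_measurable A Eu.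
Proof. exact: condexp_csub_measurable. Qed.

Lemma is_orlicz_supported_cintegrable f B : measurable B -> (mu B < +oo)%E ->
  is_orlicz mu Phi f -> (forall x, ~ B x -> f x = 0) -> cintegrable mu setT f.
Proof.
move=> mB Boo of_ f0; rewrite (_ : f = cut B f).
  by apply: cintegrable_cut => //; exact: (is_orlicz_cintegrable of_ mB Boo).
by apply/funext => x; rewrite /cut; case: ifPn => // /negP Bx; apply: f0 => /mem_set.
Qed.

(* [u * 1_B = u 1_B], and a function with vanishing conditional expectation is
   mapped to its product with [E u]; so [1_B] works if [u = E u] on [B], and
   [(u - E u) 1_B] does otherwise. *)
Lemma lambert_mul_eigen B (M : R) : A B -> (0 < mu B)%E -> (mu B < +oo)%E ->
  (forall x, B x -> normc (Eu x) <= M) ->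
  exists g, [/\ is_orlicz mu Phi g, forall x, ~ B x -> g x = 0,
    ~ {ae mu, forall x, g x = 0} & {ae mu, forall x, mulu g x = Eu x * g x}].
Proof.
move=> AB B0 Boo EM; have mB := A_sub AB.
have mEu : cmeasurable Eu := csub_measurableW A_sigma_algebra A_sub Eu_csub_measurable.
have [uE|uE] := pselect {ae mu, forall x, (cut B u - cut B Eu) x = 0}.
- exists (cut B (fun=> 1)); split.
  + exact: is_orlicz_cut1.
  + by move=> x Bx; exact: cut_out.
  + move=> H.
    have : mu.-negligible B.
      by apply: negligibleS H => x Bx /=; rewrite cut_in//; apply/eqP; exact: oner_neq0.
    by move=> /(negligibleP _ mB) B00; rewrite B00 ltxx in B0.
  + apply: filterS2 uE (lambert_mul_cut1 AB Boo) => x; rewrite !fctE => /eqP.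
    by rewrite subr_eq0 => /eqP -> ->; rewrite /cut; case: ifP => _; rewrite ?mulr1 ?mulr0.
- exists (cut B u - cut B Eu); split => //.
  (* The bound [M] on [Eu] over [B] is what places [cut B Eu] in the Orlicz space. *)
  + rewrite -scaleN1r; apply: is_orliczD; first exact: is_orlicz_cut_multiplier.
    by apply: is_orliczZ; exact: is_orlicz_cut_bounded EM.
  + by move=> x Bx; rewrite !fctE !cut_out// subrr.
  + have := condexp_centered A_sigma_algebra A_sub A_sigma_finite u_loc AB Boo.
    apply: filterS => x; rewrite /lambert_mul => ->; ring.
Qed.

Lemma lambert_mul_eigen_scale (k : R) B f : A B -> (mu B < +oo)%E ->
  is_orlicz mu Phi f -> (forall x, ~ B x -> f x = 0) ->
  {ae mu, forall x, mulu f x = Eu x * f x} ->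
  {ae mu, forall x, mulu (k%:C%C *: f) x = Eu x * (k%:C%C *: f) x}.
Proof.
move=> AB Boo of_ f0 fE; have mB := A_sub AB.
have [mf _] := of_; have fi := is_orlicz_supported_cintegrable mB Boo of_ f0.
have m0 : cmeasurable (0 : X -> R[i]) by split; exact: measurable_cst.
have i0 : cintegrable mu setT (0 : X -> R[i]) by split; exact: integrable0.
(* Homogeneity is linearity with second summand 0. The product of [u] with 0 still involves the
   chosen version of the conditional expectation of 0, which has to be shown null almost
   everywhere. *)
have E0 := condexp_id A_sigma_algebra A_sub A_sigma_finite
  (_ : csub_measurable A (0 : X -> R[i])) i0.
have {}E0 := E0 (conj (measurable_cst _) (measurable_cst _)).
have H := lambert_mul_linear A_sigma_algebra A_sub A_sigma_finite u k mf m0 fi i0.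
apply: filterS3 H fE E0 => x; rewrite addr0 => -> ->.
rewrite /lambert_mul => -> /=; rewrite !fctE (_ : k%:C%C *: f x = k%:C%C * f x)//.
by ring.
Qed.

(** The norm is set to [2^-1], strictly below 1, so that [Phi_integral_luxemburg] yields
    [Phi_integral mu Phi 1 g <= 1]. *)
Lemma lambert_mul_eigen_normalized B (M : R) : A B -> (0 < mu B)%E -> (mu B < +oo)%E ->
  (forall x, B x -> normc (Eu x) <= M) ->
  exists g, [/\ is_orlicz mu Phi g, forall x, ~ B x -> g x = 0,
    luxemburg mu Phi g = 2^-1 & {ae mu, forall x, mulu g x = Eu x * g x}].
Proof.
move=> AB B0 Boo EM.
have [g [og g0 gn0 gE]] := lambert_mul_eigen AB B0 Boo EM.
pose l := luxemburg mu Phi g.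
have l0 : 0 < l.
  rewrite lt_neqAle luxemburg_ge0// andbT eq_sym; apply/eqP => l0; apply: gn0.
  exact: luxemburg_eq0 l0.
pose k := 2^-1 / l; have k0 : 0 < k by rewrite divr_gt0.
exists (k%:C%C *: g); split.
- exact: is_orliczZ.
- by move=> x Bx; rewrite fctE g0// scaler0.
- by rewrite luxemburgZ// normc_real gtr0_norm// -/l divfK// gt_eqF.
- exact: lambert_mul_eigen_scale Boo og g0 gE.
Qed.

End multiplier.

(** * Gluing functions with disjoint supports *)

(** The coefficients of the [w i] on the [v j] form a matrix with one more row than columns, so its
    left kernel contains a nonzero row. *)
Lemma spanned_dependent (K : numFieldType) (U : lmodType K) n (v : 'I_n -> U)
    (w : 'I_n.+1 -> U) : (forall i, spanned v (w i)) ->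
  exists2 c : 'I_n.+1 -> K, (exists i, c i != 0) & \sum_i c i *: w i = 0.
Proof.
move=> wv.
have wv' i : exists c : 'I_n -> K, \sum_j c j *: v j = w i.
  by have [c _ cE] := wv i; exists c.
have [C CE] := choice wv'.
pose M := \matrix_(i < n.+1, j < n) C i j.
have : kermx M != 0.
  rewrite -mxrank_eq0 mxrank_ker subn_eq0 -ltnNge ltnS.
  exact: rank_leq_col.
move=> /rowV0Pn[r /sub_kermxP rM r0].
exists (r 0).
  apply: contrapT => H; move/negP: r0; apply; apply/eqP/rowP => i; rewrite mxE.
  by apply: contrapT => /eqP ri; apply: H; exists i.
under eq_bigr do rewrite -CE scaler_sumr.
rewrite exchange_big /= big1// => j _.
under eq_bigr do rewrite scalerA.
rewrite -scaler_suml (_ : \sum_i r 0 i * C i j = (r *m M) 0 j).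
  by rewrite rM mxE scale0r.
by rewrite mxE; apply: eq_bigr => i _; rewrite !mxE.
Qed.

Lemma orlicz_class_sum0 d (X : measurableType d) (R : realType)
    (mu : {measure set X -> \bar R}) (Phi : youngFun R) n
    (c : 'I_n -> R[i]) (w : 'I_n -> orliczFun mu Phi) :
  \sum_i c i *: orlicz_class (w i) = 0 ->
  {ae mu, forall x, \sum_i c i * w i x = 0}.
Proof.
have class0 : orlicz_class (0 : orliczFun mu Phi) = 0 by exact: pi_zeror.
have -> : \sum_i c i *: orlicz_class (w i) = orlicz_class (\sum_i c i *: w i).
  rewrite (big_morph _ (@orlicz_classD _ _ _ mu Phi) class0).
  by apply: eq_bigr => i _; rewrite orlicz_classZ.
rewrite -class0 => /orlicz_classP; apply: filterS => x.
suff -> : orlicz_fun (\sum_i c i *: w i) x = \sum_i c i * w i x by [].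
by elim/big_rec2: _ => // i y z _ <-.
Qed.

Section glue.
Context d (X : measurableType d) (R : realType).
Variables (B : nat -> set X) (a : nat -> R) (f : nat -> X -> R[i]).
Hypothesis tB : trivIset setT B.
Hypothesis f0 : forall k x, ~ B k x -> f k x = 0.

(** The default index 0 outside all blocks is harmless, since [f 0] vanishes off [B 0]. *)
Definition block (x : X) : nat := xget 0%N [set k | B k x].

Definition glue (x : X) : R[i] := (a (block x))%:C%C * f (block x) x.

Fixpoint partial_glue n : X -> R[i] :=
  if n is m.+1 then (a m)%:C%C *: f m + partial_glue m else 0.

Lemma block_eq k x : B k x -> block x = k.
Proof.
move=> Bkx; have Bx : B (block x) x by rewrite /block; case: xgetP => [j _ //|/(_ k)].
by apply: tB => //; exists x.
Qed.

Lemma glue_in k x : B k x -> glue x = (a k)%:C%C * f k x.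
Proof. by move=> /block_eq; rewrite /glue => ->. Qed.

Lemma glue_out x : (forall k, ~ B k x) -> glue x = 0.
Proof. by move=> Bx; rewrite /glue f0 ?mulr0. Qed.

Lemma partial_glueE n x :
  partial_glue n x = if (block x < n)%N then glue x else 0.
Proof.
elim: n => [//|n IH] /=.
rewrite fctE IH (_ : ((a n)%:C%C *: f n) x = (a n)%:C%C * f n x)// ltnS.
have [xn|xn|xn] := ltngtP (block x) n.
- by rewrite f0 ?mulr0 ?add0r// => /block_eq xE; rewrite xE ltnn in xn.
- by rewrite f0 ?mulr0 ?add0r// => /block_eq xE; rewrite xE ltnn in xn.
- by rewrite addr0 /glue xn.
Qed.

(** At each point the partial sums are eventually constant, so the glued function is their pointwise
    limit. *)
Lemma cmeasurable_glue : (forall k, cmeasurable (f k)) -> cmeasurable glue.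
Proof.
move=> mf; have mp n : cmeasurable (partial_glue n).
  elim: n => [|n IH] /=; first by split; exact: measurable_cst.
  exact/cmeasurableD/IH/cmeasurableZ.
have lim_p (V : R[i] -> R) x : V (partial_glue n x) @[n --> \oo] --> V (glue x).
  apply: cvg_near_cst; exists (block x).+1 => // n /= xn.
  by rewrite partial_glueE xn.
split.
- apply: (measurable_fun_cvg (h := fun n x => complex.Re (partial_glue n x))).
  + by move=> n; case: (mp n).
  + by move=> x _; exact: lim_p.
- apply: (measurable_fun_cvg (h := fun n x => complex.Im (partial_glue n x))).
  + by move=> n; case: (mp n).
  + by move=> x _; exact: lim_p.
Qed.

End glue.

Section glue_bound.
Context d (X : measurableType d) (R : realType).
Variables (mu : {measure set X -> \bar R}) (Phi : youngFun R).
Variables (B : nat -> set X) (f : nat -> X -> R[i]).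
Hypothesis mB : forall k, measurable (B k).
Hypothesis tB : trivIset setT B.

(** The integral splits over the disjoint blocks. On [B k] convexity pulls the factor
    [(2 ^ k.+1)%:R^-1] out of [Phi], and these factors sum to 1. *)
Lemma Phi_integral_blocks (t : X -> R[i]) : cmeasurable t ->
  (forall k, cmeasurable (f k)) ->
  (forall x, (forall k, ~ B k x) -> t x = 0) ->
  (forall k x, B k x -> normc (t x) <= (2 ^ k.+1)%:R^-1 * normc (f k x)) ->
  (forall k, Phi_integral mu Phi 1 (f k) <= 1)%E ->
  (Phi_integral mu Phi 1 t <= 1)%E.
Proof.
move=> mt mf t0 tf f1.
have mPhi g : cmeasurable g -> measurable_fun setT (fun x => (Phi (1 * normc (g x)))%:E).
  by move=> mg; exact: measurable_Phi.
pose D := \bigcup_k B k.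
have mD : measurable D by exact: bigcupT_measurable.
have Phi0 g x : (0 <= (Phi (1 * normc (g x : R[i])))%:E)%E by rewrite lee_fin young_ge0.
rewrite /Phi_integral (_ : (fun x => _) =
    (fun x => (Phi (1 * normc (t x)))%:E) \_ D); last first.
  apply/funext => x; rewrite patchE; case: ifPn => // /negP Dx.
  rewrite t0 ?ComplexField.Normc.normc0 ?mulr0 ?young0// => k Bkx.
  by apply: Dx; apply/mem_set; exists k.
rewrite -integral_mkcond ge0_integral_bigcup//; last first.
  by apply: measurable_funTS; exact: mPhi.
apply: (@le_trans _ _ (\sum_(k <oo) (1 / (2 ^ k.+1)%:R)%:E)%E); last first.
  exact: epsilon_trick0.
apply: lee_nneseries => [k _ _|k _]; first exact: integral_ge0.
have p0 : 0 < (2 ^ k.+1)%:R^-1 :> R by rewrite invr_gt0 ltr0n expn_gt0.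
have p1 : (2 ^ k.+1)%:R^-1 <= 1 :> R by rewrite invf_le1 ?ltr0n ?expn_gt0// ler1n expn_gt0.
rewrite div1r -[leRHS]mule1.
apply: (@le_trans _ _ ((2 ^ k.+1)%:R^-1%:E * Phi_integral mu Phi 1 (f k))%E); last first.
  by apply: lee_wpmul2l => //; rewrite lee_fin ltW.
rewrite /Phi_integral -ge0_integralZl//; last exact: mPhi.
apply: (@le_trans _ _ (\int[mu]_(x in B k)
    ((2 ^ k.+1)%:R^-1%:E * (Phi (1 * normc (f k x)))%:E))%E).
  apply: ge0_le_integral => //.
  - by apply: measurable_funTS; exact: mPhi.
  - by apply: measurable_funTS; apply: measurable_funeM; exact: mPhi.
  - move=> x Bx; rewrite -EFinM lee_fin !mul1r.
    apply: le_trans (young_scale Phi _ _); last by rewrite (ltW p0).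
    by apply: young_le; [exact: normc_ge0|exact: tf].
apply: ge0_subset_integral => //.
- by apply: measurable_funeM; exact: mPhi.
- by move=> x _; rewrite mule_ge0// lee_fin ltW.
Qed.

End glue_bound.

Lemma cmeasurableM d (X : measurableType d) (R : realType) (f g : X -> R[i]) :
  cmeasurable f -> cmeasurable g -> cmeasurable (fun x => f x * g x).
Proof.
move=> [fR fI] [gR gI]; split.
- rewrite (_ : (fun x => _) = (fun x => complex.Re (f x) * complex.Re (g x)
      - complex.Im (f x) * complex.Im (g x))).
    by apply: measurable_funB; exact: measurable_funM.
  by apply/funext => x; case: (f x); case: (g x).
- rewrite (_ : (fun x => _) = (fun x => complex.Re (f x) * complex.Im (g x)
      + complex.Im (f x) * complex.Re (g x))).
    by apply: measurable_funD; exact: measurable_funM.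
  by apply/funext => x; case: (f x); case: (g x).
Qed.

Lemma cintegrable_linear d (X : measurableType d) (R : realType)
    (mu : {measure set X -> \bar R}) (a : R) (f g : X -> R[i]) :
  cintegrable mu setT f -> cintegrable mu setT g ->
  cintegrable mu setT (a%:C%C *: f + g).
Proof.
move=> [fR fI] [gR gI]; split.
- apply: eq_integrable (integrableD measurableT (integrableZl measurableT a fR) gR) => //.
  move=> x _; rewrite /= fctE -EFinM -EFinD; congr _%:E.
  by rewrite !fctE; case: (f x); case: (g x) => p q r s /=; rewrite mul0r subr0.
- apply: eq_integrable (integrableD measurableT (integrableZl measurableT a fI) gI) => //.
  move=> x _; rewrite /= fctE -EFinM -EFinD; congr _%:E.
  by rewrite !fctE; case: (f x); case: (g x) => p q r s /=; rewrite mul0r addr0.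
Qed.

Lemma orlicz_classB d (X : measurableType d) (R : realType)
    (mu : {measure set X -> \bar R}) (Phi : youngFun R) (f g : orliczFun mu Phi) :
  orlicz_class (f - g) = orlicz_class f - orlicz_class g.
Proof. by rewrite -scaleN1r orlicz_classD orlicz_classZ scaleN1r. Qed.

(** * The series over the blocks and the dimension of the kernel *)

Section small_condexp.
Context d (X : measurableType d) (R : realType).
Variables (mu : {measure set X -> \bar R}) (A : set (set X)) (Phi : youngFun R).
Hypothesis A_sigma_algebra : sigma_algebra [set: X] A.
Hypothesis A_sub : A `<=` d.-measurable.
Hypothesis A_sigma_finite :
  @sigma_finite _ (g_sigma_algebraType A) R [set: X] mu.
Variable u : X -> R[i].
Hypothesis u_multiplier : lambert_multiplier mu A Phi u.
Local Notation Eu := (condexp mu A u).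
Local Notation mulu := (lambert_mul mu A u).
Local Notation Tu := (lambert_op u_multiplier).

Variables (B : nat -> set X) (f : nat -> X -> R[i]).
Hypothesis AB : forall k, A (B k).
Hypothesis Boo : forall k, (mu (B k) < +oo)%E.
Hypothesis tB : trivIset setT B.
Hypothesis EuB : forall k x, B k x -> normc (Eu x) <= (8 ^+ k)^-1.
Hypothesis of_ : forall k, is_orlicz mu Phi (f k).
Hypothesis f0 : forall k x, ~ B k x -> f k x = 0.
Hypothesis fn : forall k, luxemburg mu Phi (f k) = 2^-1.
Hypothesis fE : forall k, {ae mu, forall x, mulu (f k) x = Eu x * f k x}.

Let mB k : measurable (B k). Proof. exact/A_sub/AB. Qed.

Let mEu : cmeasurable Eu.
Proof.
apply: (csub_measurableW A_sigma_algebra) => //.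
exact: (Eu_csub_measurable A_sigma_algebra A_sub A_sigma_finite u_multiplier).
Qed.

Let mf k : cmeasurable (f k). Proof. by case: (of_ k). Qed.

Let fi k : cintegrable mu setT (f k).
Proof. exact: (is_orlicz_supported_cintegrable (mB k) (Boo k) (of_ k) (@f0 k)). Qed.

(** The weights make the glued function too large on the blocks to be the restriction of a single
    element of the space, while its product [y] with [Eu] converges: on [B k] the factor [8 ^+ k] in
    the bound on [Eu] absorbs [a k] and leaves geometric decay. *)
Let a k : R := 2 ^+ k.
Let y x := Eu x * glue B a f x.
Let h n := partial_glue a f n.

Let is_orlicz_h n : is_orlicz mu Phi (h n).
Proof.
elim: n => [|n IH]; first exact: is_orlicz0.
exact/is_orliczD/IH/is_orliczZ.
Qed.

Let mulu_h n : cintegrable mu setT (h n) /\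
  {ae mu, forall x, mulu (h n) x = Eu x * h n x}.
Proof.
elim: n => [|n [hi hE]].
  have m0 : csub_measurable A (0 : X -> R[i]) by split; exact: measurable_cst.
  have i0 : cintegrable mu setT (0 : X -> R[i]) by split; exact: integrable0.
  split => //.
  apply: filterS (condexp_id A_sigma_algebra A_sub A_sigma_finite m0 i0) => x.
  by rewrite /lambert_mul => ->; rewrite !mulr0 mul0r !addr0 subr0.
have mh : cmeasurable (h n) by case: (is_orlicz_h n).
split; first exact: cintegrable_linear.
have := lambert_mul_linear A_sigma_algebra A_sub A_sigma_finite u (a n) (mf n) mh (fi n) hi.
apply: filterS3 (fE n) hE => x fx hx; rewrite /h /= => ->; rewrite fx hx.
by rewrite !fctE (_ : (a n)%:C%C *: f n x = (a n)%:C%C * f n x)//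
  -/(h n); ring.
Qed.

Let tail n x := y x - Eu x * h n x.

Let my : cmeasurable y.
Proof. exact/cmeasurableM/cmeasurable_glue. Qed.

Let m_tail n : cmeasurable (tail n).
Proof.
rewrite (_ : tail n = y + (-1) *: (fun x => Eu x * h n x)); last first.
  by apply/funext => x; rewrite scaleN1r.
apply/cmeasurableD/cmeasurableZ/cmeasurableM => //.
by case: (is_orlicz_h n).
Qed.

Let c n : R := 2 ^+ n / 2.

Let c_gt0 n : 0 < c n. Proof. by rewrite divr_gt0// exprn_gt0. Qed.

(** The tail vanishes on [B k] for [k < n]. For [n <= k] its factor there is at most
    [c k * (8 ^+ k)^-1 * a k], which is exactly the weight [2 ^- k.+1] of [Phi_integral_blocks]. *)
Let Phi_integral_tail n : (Phi_integral mu Phi (c n) (tail n) <= 1)%E.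
Proof.
have -> : c n = 1 * normc (c n)%:C%C by rewrite mul1r normc_real gtr0_norm.
rewrite -Phi_integralZ; apply: (Phi_integral_blocks (B := B) (f := f)) => //.
- exact: cmeasurableZ.
- move=> x Bx; rewrite fctE /tail /y /h (partial_glueE a tB f0) glue_out//.
  by rewrite if_same !mulr0 subr0 scaler0.
- move=> k x Bkx; rewrite fctE /tail /y /h (partial_glueE a tB f0) (block_eq tB Bkx).
  rewrite (glue_in a f tB Bkx).
  have [kn|nk] := ltnP k n.
    rewrite subrr scaler0 ComplexField.Normc.normc0.
    by rewrite mulr_ge0 ?normc_ge0// invr_ge0.
  rewrite mulr0 subr0.
  have -> : normc ((c n)%:C%C *: (Eu x * ((a k)%:C%C * f k x))) =
      c n * (normc (Eu x) * (a k * normc (f k x))).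
    rewrite (_ : _ *: _ = (c n)%:C%C * (Eu x * ((a k)%:C%C * f k x)))//.
    rewrite !ComplexField.Normc.normcM !normc_real (gtr0_norm (c_gt0 n)).
    by rewrite ger0_norm// exprn_ge0.
  rewrite !mulrA; apply: ler_wpM2r; first exact: normc_ge0.
  apply: (@le_trans _ _ (c k * (8 ^+ k)^-1 * a k)).
    apply: ler_wpM2r; first exact: exprn_ge0.
    apply: ler_pM; [exact: ltW|exact: normc_ge0| |exact: EuB].
    by rewrite ler_wpM2r// ler_weXn2l// ler1n.
  rewrite /c /a natrX exprS invfM (_ : 8 = 2 * 2 * 2 :> R); last by ring.
  rewrite !exprMn !invfM.
  have p0 : 2 ^+ k != 0 :> R by rewrite expf_neq0.
  by rewrite le_eqVlt; apply/orP; left; apply/eqP; field.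
- move=> k; have := @Phi_integral_luxemburg _ _ _ mu Phi 1 (f k) (of_ k).
  by rewrite invr1; apply; rewrite fn invf_lt1// ltr1n.
Qed.

Let is_orlicz_tail n : is_orlicz mu Phi (tail n).
Proof.
split => //; exists (c n) => //.
by apply: le_lt_trans (Phi_integral_tail n) _; rewrite ltry.
Qed.

Let luxemburg_tail n : luxemburg mu Phi (tail n) <= (c n)^-1.
Proof. by apply: luxemburg_le; rewrite ?invrK// invr_gt0. Qed.

(** [h 0] is zero, so the tail estimate at 0 already concerns [y]. *)
Let is_orlicz_y : is_orlicz mu Phi y.
Proof.
rewrite (_ : y = tail 0) //.
by apply/funext => x; rewrite /tail /h /= mulr0 subr0.
Qed.

Let yO := OrliczFun (introT (orlicz_predP mu Phi y) is_orlicz_y).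
Let hO n := OrliczFun (introT (orlicz_predP mu Phi (h n)) (is_orlicz_h n)).

Let norm_tail n : `|orlicz_class yO - Tu (orlicz_class (hO n))| <= ((c n)^-1)%:C%C.
Proof.
rewrite lambert_opE// -orlicz_classB orlicz_normrE lecR.
apply: le_trans (luxemburg_tail n).
rewrite le_eqVlt; apply/orP; left; apply/eqP; apply: luxemburg_ae => //.
  by case: (is_orlicz_fun (yO - lambert_fun u_multiplier (hO n))).
by apply: filterS (mulu_h n).2 => x hx; rewrite /tail -hx.
Qed.

Lemma closed_range_glue : closed (range Tu) -> range Tu (orlicz_class yO).
Proof.
move=> clT; apply: clT => U /nbhs_ballP[e e0 eU].
(* Radii are complex here; positivity in [R[i]] means a zero imaginary part and a positive real
   part. *)
move: e e0 eU => [er ei] e0 eU.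
have := e0; rewrite /= ltcE /= => /andP[/eqP ei0 er0].
(* The distance from [y] to the image of [h n] is at most [2 / 2 ^+ n], and [2 ^+ n] exceeds
   [2 / er] for this [n]. *)
pose n := Num.bound (2 / er).
exists (Tu (orlicz_class (hO n))); split; first by exists (orlicz_class (hO n)).
apply: eU; rewrite -ball_normE /=; apply: le_lt_trans (norm_tail n) _.
rewrite ltcE /= ei0 eqxx /= /c invf_div ltr_pdivrMr ?exprn_gt0//.
rewrite mulrC -ltr_pdivrMr//.
apply: (lt_le_trans (archi_boundP _)); first by rewrite divr_ge0// ltW.
by rewrite -natrX ler_nat ltnW// ltn_expl.
Qed.

Lemma closed_range_infinite_kernel (n : nat) (v : 'I_n -> orlicz mu Phi) :
  closed (range Tu) -> ~ (Tu @^-1` [set 0] `<=` spanned v).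
Proof.
move=> /closed_range_glue[G _ TG] ker_v.
pose g := orlicz_repr G; have og := is_orlicz_fun g.
have gy : {ae mu, forall x, mulu g x = y x} by move/orlicz_classP : TG.
have g_loc := is_orlicz_csub_integrable A_sub og.
have mg : cmeasurable g by case: og.
pose W k : X -> R[i] := (- a k)%:C%C *: f k + cut (B k) g.
have WE k x : W k x = (- a k)%:C%C * f k x + cut (B k) g x by [].
have oW k : is_orlicz mu Phi (W k).
  by apply: is_orliczD; [exact: is_orliczZ|exact: is_orlicz_cut].
have W0 k x : ~ B k x -> W k x = 0.
  by move=> Bx; rewrite WE f0// cut_out// mulr0 addr0.
pose WO k := OrliczFun (introT (orlicz_predP mu Phi (W k)) (oW k)).
have class0 : orlicz_class (0 : orliczFun mu Phi) = 0 by exact: pi_zeror.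
have TW k : Tu (orlicz_class (WO k)) = 0.
  rewrite lambert_opE// -class0; apply/orlicz_classP.
  have gi : cintegrable mu setT (cut (B k) g).
    by apply: cintegrable_cut => //; exact: csub_integrable_on g_loc _ _.
  have H1 := lambert_mul_linear A_sigma_algebra A_sub A_sigma_finite u (- a k)
    (mf k) (cmeasurable_cut (mB k) mg) (fi k) gi.
  have H2 := lambert_mul_cut A_sigma_algebra A_sub A_sigma_finite u g_loc (AB k) (Boo k).
  have H3 : {ae mu, forall x, mulu (f k) x = Eu x * f k x /\ mulu g x = y x}.
    by apply: filterS2 (fE k) gy => x.
  apply: filterS3 H1 H2 H3 => x /= -> -> [-> gx].
  (* On [B k] the image of [g] is [y = Eu * (2 ^+ k * f k)], which cancels the image of the first
     summand of [W k]; off [B k] both summands vanish. *)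
  have [Bx|Bx] := pselect (B k x).
    by rewrite cut_in// gx /y (glue_in a f tB Bx) rmorphN; ring.
  by rewrite f0// cut_out// !mulr0 addr0.
(* Any [k >= N] satisfies [2 * luxemburg mu Phi g < 2 ^+ k]. Starting the [n.+1] kernel elements at
   [N] guarantees that the one forced to vanish has such an index. *)
pose N := Num.bound (2 * luxemburg mu Phi g).
have [b [i bi] sum0] := spanned_dependent
  (fun j : 'I_n.+1 => ker_v (orlicz_class (WO (N + j)%N)) (TW _)).
have := orlicz_class_sum0 sum0; rewrite /= => {}sum0.
pose k := (N + i)%N.
have gk : {ae mu, forall x, cut (B k) g x = ((a k)%:C%C *: f k) x}.
  apply: filterS sum0 => x.
  rewrite fctE (_ : (a k)%:C%C *: f k x = (a k)%:C%C * f k x)//.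
  (* On [B k] disjointness leaves a single term of the dependence relation, whose coefficient [b i]
     is nonzero, so [W k] vanishes there. *)
  have [Bx|Bx] := pselect (B k x); last by rewrite f0// cut_out// mulr0.
  rewrite (bigD1 i)//= big1 ?addr0; last first.
    move=> j ji; rewrite W0 ?mulr0// => Bj; move/negP: ji; apply.
    have : (N + j)%N = k by apply: tB => //; exists x.
    by move/addnI => /val_inj ->.
  move/eqP; rewrite mulf_eq0 (negbTE bi)/= -/k => /eqP; rewrite WE rmorphN mulNr.
  by move/eqP; rewrite addrC subr_eq0 => /eqP.
have : a k / 2 <= luxemburg mu Phi g.
  apply: le_trans (luxemburg_cut (mB k) og).
  rewrite (luxemburg_ae Phi (cmeasurable_cut (mB k) mg) _ gk); last exact: cmeasurableZ.
  by rewrite luxemburgZ// normc_real fn ger0_norm// exprn_ge0.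
apply/negP; rewrite -ltNge ltr_pdivlMr// mulrC.
apply: (lt_le_trans (archi_boundP _)); first by rewrite mulr_ge0// luxemburg_ge0.
rewrite -/N /a -natrX ler_nat (leq_trans (ltnW (ltn_expl N (ltnSn 1))))//.
by rewrite leq_exp2l// leq_addr.
Qed.

End small_condexp.

(** * From sublevel sets of [|E(u)|] to the lower bound *)

Theorem theorem3p2 (R : realType) (d : measure_display) (X : measurableType d)
    (mu : {measure set X -> \bar R}) (A : set (set X)) (Phi : youngFun R)
    (mu_complete : measure_is_complete mu)
    (mu_sigma_finite : sigma_finite [set: X] mu)
    (A_sigma_algebra : sigma_algebra [set: X] A)
    (A_sub : A `<=` d.-measurable)
    (A_complete : @measure_is_complete _ (g_sigma_algebraType A) R mu)
    (A_sigma_finite :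
      @sigma_finite _ (g_sigma_algebraType A) R [set: X] mu)
    (Phi_Delta2 : Delta2 Phi)
    (A_non_atomic : non_atomic mu A)
    (u : X -> R[i]) (u_multiplier : lambert_multiplier mu A Phi u) :
  fredholm (lambert_op u_multiplier) ->
  exists2 delta : R, 0 < delta &
    {ae mu, forall x, delta <= normc (condexp mu A u x)}.
Proof.
move=> [clT [n [v [_ ker_v]]] _]; apply: contrapT => H.
have mEu := Eu_csub_measurable A_sigma_algebra A_sub A_sigma_finite u_multiplier.
pose S k := [set x | normc (condexp mu A u x) <= (8 ^+ k)^-1].
have AS k : A (S k).
  rewrite -sub_measurableE// -[S k]setTI.
  by apply: measurable_fun_le => //; exact: (@measurable_normc _ (g_sigma_algebraType A) R).
(* If some sublevel set were null, its threshold [(8 ^+ k)^-1] would be an admissible [delta]. *)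
have S0 k : (0 < mu (S k))%E.
  rewrite lt0e measure_ge0 andbT; apply/eqP => Sk0; apply: H.
  exists (8 ^+ k)^-1; first by rewrite invr_gt0 exprn_gt0.
  exists (S k); split => //; first exact: A_sub.
  by move=> x /= /negP; rewrite -ltNge => /ltW.
have [B [AB BS B0 tB]] := non_atomic_disjoint A_sigma_algebra A_sub A_sigma_finite
  A_non_atomic AS S0.
have Boo k : (mu (B k) < +oo)%E by case/andP: (B0 k).
have EuB k x : B k x -> normc (condexp mu A u x) <= (8 ^+ k)^-1 by move/BS.
have fP k : exists g, [/\ is_orlicz mu Phi g, forall x, ~ B k x -> g x = 0,
    luxemburg mu Phi g = 2^-1 &
    {ae mu, forall x, lambert_mul mu A u g x = condexp mu A u x * g x}].
  have /andP[Bk0 _] := B0 k.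
  exact: (lambert_mul_eigen_normalized A_sigma_algebra A_sub A_sigma_finite
    u_multiplier (AB k) Bk0 (Boo k) (@EuB k)).
have [f {}fP] := choice fP.
have of_ k : is_orlicz mu Phi (f k) by have [] := fP k.
have f0 k x : ~ B k x -> f k x = 0 by have [_ + _ _] := fP k; exact.
have fn k : luxemburg mu Phi (f k) = 2^-1 by have [] := fP k.
have fE k : {ae mu, forall x, lambert_mul mu A u (f k) x = condexp mu A u x * f k x}.
  by have [] := fP k.
exact: (closed_range_infinite_kernel A_sigma_algebra A_sub A_sigma_finite AB Boo tB
  EuB of_ f0 fn fE clT ker_v).
Qed.
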